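(* Let $(M,\Omega,\Gamma,Z,h)$ be a Joyce structure with $n=\dim_{\mathbb C}M$, let $\mathcal{A}=h+\epsilon^{-1}v$ and $\mathcal{A}^{\mathrm{st}}=\mathcal{H}+\epsilon^{-1}v$ be the associated and the trivial formal relative connections, and let $\dot g\in\mathrm{Lie}(\widehat{\mathcal G})$ be any element satisfying $e^{\mathcal{L}_{\dot g}}\mathcal{A}^{\mathrm{st}}=\mathcal{A}$. Let $(Z^i)$ be $\nabla$-flat Darboux coordinates on an open set $U\subset M$ and $(Z^i,\theta^i)$ the induced coordinates on $\pi^{-1}(U)\subset TM$. Put $x^{i,\mathrm{st}}:=\theta^i-\epsilon^{-1}Z^i$ and define $x^i\in\epsilon^{-1}\cdot\mathcal{O}_{TM}(\pi^{-1}(U))[[\epsilon]]$ by $$x^i:=e^{\dot g}x^{i,\mathrm{st}}=\sum_{k=0}^\infty\frac{\dot g^k(x^{i,\mathrm{st}})}{k!},\qquad i=1,\dots,n.$$ Then $$\mathcal{A}_{\partial_{Z^j}}(x^i)=0\qquad\text{for } i,j=1,\dots,n.$$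
   Context: All objects and morphisms are holomorphic. $\pi:TM\to M$ is the tangent bundle projection and $V_\pi=\mathrm{Ker}(\pi_* )\subset T(TM)$ the vertical bundle. $v:\pi^*(TM)\to V_\pi$ is the canonical identification: in coordinates $(Z^i,\theta^i)$ on $TM$ induced by coordinates $(Z^i)$ on $M$, $v_{\partial_{Z^i}}=\partial_{\theta^i}$. An (Ehresmann) connection on $\pi$ is a bundle map $h:\pi^*(TM)\to T(TM)$ with $\pi_*\circ h=\mathrm{Id}$; for a local vector field $X$ on $M$, $h_X=h(X)$ denotes the lifted vector field on $TM$. It is flat if its image distribution is involutive, equivalently $[h_X,h_Y]=h_{[X,Y]}$ for all local vector fields $X,Y$ on $M$. For a holomorphic symplectic form $\Omega$ on $M$, $\Omega^v$ is the fibrewise symplectic form on $V_\pi$ with $\Omega^v(v_X,v_Y)=\Omega(X,Y)$; a connection is symplectic if its parallel transport maps between open subsets of fibres of $\pi$ preserve $\Omega^v$. A pre-Joyce structure on $(M,\Omega)$ is a connection $h$ on $\pi$ such that $\mathcal{A}^\epsilon=h+\epsilon^{-1}v$ is flat and symplectic for each $\epsilon\in\mathbb{C}^*$. A period structure on $M$ is a pair $(\Gamma,Z)$ where $\Gamma\to M$ is a bundle of full lattices in $TM$ ($\Gamma_p\subset T_pM$ a discrete finitely generated subgroup with $\Gamma_p\otimes_{\mathbb Z}\mathbb{C}=T_pM$), and $Z$ is a holomorphic vector field on $M$ with $\nabla Z=\mathrm{Id}_{TM}$, where $\nabla$ is the flat linear connection on $TM$ for which local sections of $\Gamma$ are flat.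 A Joyce structure $(M,\Omega,\Gamma,Z,h)$ is a pre-Joyce structure $(\Omega,h)$ together with a period structure $(\Gamma,Z)$ such that: (J1) $(2\pi\mathrm{i})^{-1}\Omega^{-1}$ takes integral values on the dual lattices $\Gamma^*\subset T^*M$; (J2) $h$ is invariant under translations by $(2\pi \mathrm{i})\Gamma\subset TM$; (J3) if $E$ is the $\nabla$-horizontal lift of $Z$ to $TM$, then $h([Z,X])=[E,h(X)]$ for every vector field $X$ on $M$; (J4) $h$ is invariant under the involution of $TM$ acting by $-1$ on the fibres of $\pi$. $\mathcal{H}$ is the Ehresmann connection on $\pi$ induced by $\nabla$. $\nabla$-flat Darboux coordinates $(Z^i)$ are local coordinates with $\nabla(\mathrm{d}Z^i)=0$ and $\Omega$ having constant coefficients; in the induced coordinates $\mathcal{H}_{\partial_{Z^i}}=\partial_{Z^i}$. Formal objects: $\epsilon$ is a formal variable. $\mathrm{Lie}(\widehat{\mathcal G})$ is the set of series $\dot g=\sum_{k\ge1}\dot g_k\epsilon^k$ with each $\dot g_k$ a global vertical vector field on $TM$ (section of $V_\pi\to TM$). For a formal relative connection $\mathcal{B}=\epsilon^{-1}v+h'$, $(e^{\mathcal{L}_{\dot g}}\mathcal{B})_X=\sum_{k\ge0}\frac{1}{k!}\mathcal{L}_{\dot g}^k(\mathcal{B}_X)$ for local vector fields $X$ on $M$, with $\mathcal{L}_{\dot g}Y=[\dot g,Y]$. $\dot g$ and $\mathcal{A}_{\partial_{Z^j}}$ act on formal series of functions as derivations, linearly in $\epsilon$. *)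

(* Defs.v *)
From HB Require Import structures.
From mathcomp Require Export all_boot all_order all_algebra complex.
From mathcomp Require Export boolp classical_sets functions reals topology
  normedtype derive trigo.
Export Order.TTheory GRing.Theory Num.Theory.
Export numFieldNormedType.Exports.

Set Implicit Arguments.
Unset Strict Implicit.
Unset Printing Implicit Defensive.

Local Open Scope classical_set_scope.
Local Open Scope complex_scope.
Local Open Scope ring_scope.

#[warnings="-redundant-canonical-projection"]
HB.instance Definition _ (R : rcfType) := NormedModule.copy R[i] R[i]^o.

Notation Cvec R n := 'rV[R[i]]_n.

(* A map is holomorphic if it is smooth with C-linear differential (the
   convention of Griffiths-Harris): ['d] and [differentiable] are taken over
   the field R[i], and all iterated derivatives are required to exist. *)
Fixpoint hol_upto {R : realType} {n : nat} {W : normedModType R[i]} (k : nat)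
    (D : set (Cvec R n)) (f : Cvec R n -> W) : Prop :=
  if k is k'.+1 then
    (forall x, D x -> differentiable f x) /\
    (forall v, hol_upto k' D (fun x => 'd f x v))
  else True.

Definition hol {R : realType} {n : nat} {W : normedModType R[i]}
    (D : set (Cvec R n)) (f : Cvec R n -> W) : Prop :=
  forall k, hol_upto k D f.

(* [bwd] is only meaningful on the image [fwd @` dom]. *)
Record chart (R : realType) (T : Type) (n : nat) := Chart {
  dom : set T;
  fwd : T -> Cvec R n;
  bwd : Cvec R n -> T }.

(* An atlas together with a preferred chart around every point.  The tangent
   space T_pN is C^n, a tangent vector at p being given by its components in
   the coordinates [pref p]; [tcoord] and [tvec] below convert from and to any
   other chart. *)
Record charted (R : realType) (n : nat) := Charted {
  pt :> Type;
  atlas : set (chart R pt n);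
  pref : pt -> chart R pt n }.

Arguments atlas {R n} _ _.
Arguments pref {R n} _ _.

Definition img {R : realType} {T : Type} {n : nat} (c : chart R T n)
    (O : set T) : set (Cvec R n) := fwd c @` (dom c `&` O).

Definition open_in {R : realType} {n : nat} (N : charted R n) (O : set N) :=
  forall c, atlas N c -> open (img c O).

Definition compatible {R : realType} {T : Type} {n : nat}
    (c d : chart R T n) : Prop :=
  open (img c (dom d)) /\ hol (img c (dom d)) (fwd d \o bwd c).

(* Local holomorphic coordinates, i.e. members of the maximal atlas. *)
Definition local_coordinates {R : realType} {n : nat} (N : charted R n)
    (c : chart R N n) : Prop :=
  (forall p, dom c p -> bwd c (fwd c p) = p) /\
  (forall d, atlas N d -> compatible c d /\ compatible d c).

Record complex_manifold {R : realType} {n : nat} (N : charted R n) : Prop := {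
  mfd_pref : forall p, atlas N (pref N p) /\ dom (pref N p) p;
  mfd_atlas : forall c, atlas N c -> local_coordinates c;
  mfd_hausdorff : forall p q : N, p <> q -> exists U V : set N,
    [/\ open_in U, open_in V, U p, V q & U `&` V = set0];
  mfd_countable : exists B : nat -> set N, (forall i, open_in (B i)) /\
    forall (U : set N) p, open_in U -> U p ->
      exists i, B i p /\ B i `<=` U }.

Definition hol_fun {R : realType} {n : nat} (N : charted R n) (O : set N)
    (f : N -> R[i]) : Prop :=
  forall c, atlas N c -> hol (img c O) (f \o bwd c).

Section TangentVectors.
Context {R : realType} {n : nat} (N : charted R n).

Definition tcoord (c : chart R N n) (p : N) (u : Cvec R n) : Cvec R n :=
  'd (fwd c \o bwd (pref N p)) (fwd (pref N p) p) u.

Definition tvec (c : chart R N n) (p : N) (x : Cvec R n) : Cvec R n :=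
  'd (fwd (pref N p) \o bwd c) (fwd c p) x.

(* A field on an open O is a total function whose values outside O are
   irrelevant. *)
Definition vfield := N -> Cvec R n.

Definition vrep (c : chart R N n) (X : vfield) (x : Cvec R n) : Cvec R n :=
  tcoord c (bwd c x) (X (bwd c x)).

Definition hol_vf (O : set N) (X : vfield) : Prop :=
  forall c, atlas N c -> hol (img c O) (vrep c X).

Definition bracket (X Y : vfield) : vfield := fun p =>
  let x := fwd (pref N p) p in
  'd (vrep (pref N p) Y) x (X p) - 'd (vrep (pref N p) X) x (Y p).

Definition dfun (f : N -> R[i]) (p : N) (u : Cvec R n) : R[i] :=
  'd (f \o bwd (pref N p)) (fwd (pref N p) p) u.

Definition vact (X : vfield) (f : N -> R[i]) : N -> R[i] :=
  fun p => dfun f p (X p).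

Definition coord_vf (c : chart R N n) (j : 'I_n) : vfield :=
  fun p => tvec c p (delta_mx 0 j).

End TangentVectors.

Definition tmap {R : realType} {n m : nat} (N : charted R n) (N' : charted R m)
    (F : N -> N') (p : N) (u : Cvec R n) : Cvec R m :=
  'd (fwd (pref N' (F p)) \o F \o bwd (pref N p)) (fwd (pref N p) p) u.

(* The chart (Z^i, theta^i) of TN induced by a chart (Z^i) of N. *)
Definition tchart {R : realType} {n : nat} (N : charted R n)
    (c : chart R N n) : chart R (N * Cvec R n) (n + n) :=
  Chart [set w | dom c w.1]
    (fun w => row_mx (fwd c w.1) (tcoord c w.1 w.2))
    (fun z => let p := bwd c (lsubmx z) in (p, tvec c p (rsubmx z))).

Definition tangent {R : realType} {n : nat} (N : charted R n) :
    charted R (n + n) :=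
  Charted [set tchart c | c in atlas N] (fun w => tchart (pref N w.1)).

Definition tproj {R : realType} {n : nat} (N : charted R n) (w : tangent N) : N
  := w.1.

(* The identification v : pi^*(TN) -> V_pi.  The preferred chart at w = (p, _)
   is the one induced by [pref N p], in which v sends d/dZ^i to d/dtheta^i. *)
Definition vlift {R : realType} {n : nat} (u : Cvec R n) : Cvec R (n + n) :=
  row_mx 0 u.

Section Connections.
Context {R : realType} {n : nat} (M : charted R n).

(* [h w u] is the lift to T_w(TM) of the vector u in T_(pi w)M. *)
Definition lift_map := tangent M -> Cvec R n -> Cvec R (n + n).

Definition hlift (h : lift_map) (X : vfield M) : vfield (tangent M) :=
  fun w => h w (X (tproj w)).

Record connection (h : lift_map) : Prop := {
  conn_linear : forall w, linear (h w);
  conn_hol : forall (U : set M) (X : vfield M), open_in U -> hol_vf U X ->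
    hol_vf (@tproj _ _ M @^-1` U) (hlift h X);
  conn_section : forall w u, tmap (@tproj _ _ M) w (h w u) = u }.

Definition flat_conn (h : lift_map) : Prop :=
  forall (U : set M) (X Y : vfield M), open_in U -> hol_vf U X -> hol_vf U Y ->
  forall w : tangent M, U (tproj w) ->
  bracket (hlift h X) (hlift h Y) w = hlift h (bracket X Y) w.

Definition form2 := M -> Cvec R n -> Cvec R n -> R[i].

Record symplectic_form (Om : form2) : Prop := {
  sf_linearl : forall p v, linear (fun u => Om p u v : R[i]);
  sf_linearr : forall p u, linear (fun v => Om p u v : R[i]);
  sf_alt : forall p u, Om p u u = 0;
  sf_nondeg : forall p u, (forall v, Om p u v = 0) -> u = 0;
  sf_hol : forall (U : set M) (X Y : vfield M), open_in U ->
    hol_vf U X -> hol_vf U Y -> hol_fun U (fun p => Om p (X p) (Y p));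
  sf_closed : forall (U : set M) (X Y W : vfield M), open_in U ->
    hol_vf U X -> hol_vf U Y -> hol_vf U W -> forall p, U p ->
      vact X (fun q => Om q (Y q) (W q)) p
      - vact Y (fun q => Om q (X q) (W q)) p
      + vact W (fun q => Om q (X q) (Y q)) p
      - Om p (bracket X Y p) (W p)
      + Om p (bracket X W p) (Y p)
      - Om p (bracket Y W p) (X p) = 0 }.

Definition Om_vert (Om : form2) (w : tangent M) (a b : Cvec R (n + n)) : R[i] :=
  Om (tproj w) (rsubmx a) (rsubmx b).

End Connections.

Definition continuous_path {R : realType} {n : nat} (N : charted R n)
    (gam : R -> N) : Prop :=
  forall t, `[0, 1]%classic t -> forall O : set N, open_in O -> O (gam t) ->
    \forall s \near within `[0, 1]%classic (nbhs t), O (gam s).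

Definition velocity {R : realType} {n : nat} (N : charted R n)
    (gam : R -> N) (t : R) (u : Cvec R n) : Prop :=
  let c := pref N (gam t) in
  (fun s : R => ((s - t)%:C)^-1 *: (fwd c (gam s) - fwd c (gam t)))
    @ within `[0, 1]%classic t^' --> u.

Definition C1_path {R : realType} {n : nat} (N : charted R n)
    (gam : R -> N) (dgam : R -> Cvec R n) : Prop :=
  continuous_path (fun t => (gam t, dgam t) : tangent N) /\
  forall t, `[0, 1]%classic t -> velocity gam t (dgam t).

(* On the open subset W of the fibre over gam 0, [F t] is the parallel
   transport from gam 0 to gam t: the curves t |-> F t th are horizontal. *)
Definition parallel_transport {R : realType} {n : nat} (M : charted R n)
    (h : lift_map M) (gam : R -> M) (dgam : R -> Cvec R n)
    (W : set (Cvec R n)) (F : R -> Cvec R n -> Cvec R n) : Prop :=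
  forall th, W th ->
    let lift t : tangent M := (gam t, F t th) in
    [/\ F 0 th = th, continuous_path lift &
        forall t, `[0, 1]%classic t -> velocity lift t (h (lift t) (dgam t))].

Definition symplectic_conn {R : realType} {n : nat} (M : charted R n)
    (Om : form2 M) (h : lift_map M) : Prop :=
  forall gam dgam W F, C1_path gam dgam -> open W ->
    parallel_transport h gam dgam W F ->
  forall th u v, W th ->
    Om_vert Om ((gam 1, F 1 th) : tangent M)
      (vlift ('d (F 1) th u)) (vlift ('d (F 1) th v)) =
    Om_vert Om ((gam 0, th) : tangent M) (vlift u) (vlift v).

Section LinearConnections.
Context {R : realType} {n : nat} (M : charted R n).

(* A linear connection is given by its Christoffel tensors: [G p] consists of
   the Christoffel symbols at p in the coordinates [pref M p]. *)
Definition christoffel := M -> Cvec R n -> Cvec R n -> Cvec R n.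

Definition cov (G : christoffel) (X Y : vfield M) : vfield M := fun p =>
  'd (vrep (pref M p) Y) (fwd (pref M p) p) (X p) + G p (X p) (Y p).

Record linear_connection (G : christoffel) : Prop := {
  lc_linearl : forall p v, linear (fun u => G p u v);
  lc_linearr : forall p u, linear (fun v => G p u v);
  lc_hol : forall (U : set M) (X Y : vfield M), open_in U ->
    hol_vf U X -> hol_vf U Y -> hol_vf U (cov G X Y) }.

Definition flat_linear (G : christoffel) : Prop :=
  forall (U : set M) (X Y W : vfield M), open_in U ->
    hol_vf U X -> hol_vf U Y -> hol_vf U W -> forall p, U p ->
  cov G X (cov G Y W) p - cov G Y (cov G X W) p = cov G (bracket X Y) W p.

(* (nabla_X a)(Y) for a 1-form a. *)
Definition cov_form (G : christoffel) (X : vfield M)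
    (a : M -> Cvec R n -> R[i]) (Y : vfield M) (p : M) : R[i] :=
  vact X (fun q => a q (Y q)) p - a p (cov G X Y p).

(* The Ehresmann connection H of a linear connection: a vector field Y,
   seen as a section of pi, is horizontal along X iff cov G X Y = 0. *)
Definition ehresmann (G : christoffel) : lift_map M :=
  fun w u => row_mx u (- G w.1 u w.2).

End LinearConnections.

Definition is_int {R : realType} (x : R[i]) : Prop :=
  exists m : int, x = m%:~R.

Definition two_pi_i {R : realType} : R[i] := (2 * pi : R)%:C * 'i.

(* [fl_span] and [fl_inj] say that the natural map from the tensor product
   of L with C over Z to C^n is onto and one-to-one. *)
Record full_lattice {R : realType} {n : nat} (L : set (Cvec R n)) : Prop := {
  fl_zero : L 0;
  fl_sub : forall x y, L x -> L y -> L (x - y);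
  fl_fg : exists (m : nat) (g : 'I_m -> Cvec R n),
    forall x, L x <-> exists a : 'I_m -> int, x = \sum_i g i *~ a i;
  fl_discrete : \forall x \near (0 : Cvec R n), L x -> x = 0;
  fl_span : forall v, exists (m : nat) (g : 'I_m -> Cvec R n)
    (a : 'I_m -> R[i]), (forall i, L (g i)) /\ v = \sum_i a i *: g i;
  fl_inj : forall (m : nat) (g : 'I_m -> Cvec R n), (forall i, L (g i)) ->
    (forall a : 'I_m -> int, \sum_i g i *~ a i = 0 -> forall i, a i = 0) ->
    forall a : 'I_m -> R[i], \sum_i a i *: g i = 0 -> forall i, a i = 0 }.

Section Joyce.
Context {R : realType} {n : nat} (M : charted R n).

Definition local_section (Gam : M -> set (Cvec R n)) (U : set M)
    (s : vfield M) : Prop :=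
  [/\ open_in U, hol_vf U s & forall q, U q -> Gam q (s q)].

Record lattice_bundle (Gam : M -> set (Cvec R n)) : Prop := {
  lb_fibre : forall p, full_lattice (Gam p);
  lb_trivial : forall p, exists (U : set M) (e : 'I_n -> vfield M),
    [/\ U p, forall i, local_section Gam U (e i) &
      forall q, U q -> forall x, Gam q x ->
        exists a : 'I_n -> int, x = \sum_i e i q *~ a i] }.

(* nab is the flat linear connection for which local sections of Gam are flat;
   these conditions determine it. *)
Record lattice_connection (Gam : M -> set (Cvec R n)) (nab : christoffel M) :
    Prop := {
  lattc_linear : linear_connection nab;
  lattc_flat : flat_linear nab;
  lattc_sections : forall U s, local_section Gam U s ->
    forall X p, U p -> cov nab X s p = 0 }.

Record period_structure (Gam : M -> set (Cvec R n)) (nab : christoffel M)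
    (Z : vfield M) : Prop := {
  ps_lattice : lattice_bundle Gam;
  ps_nabla : lattice_connection Gam nab;
  ps_hol : hol_vf setT Z;
  ps_euler : forall X p, cov nab X Z p = X p }.

Definition rel_conn_eps (h : lift_map M) (eps : R[i]) : lift_map M :=
  fun w u => h w u + eps^-1 *: vlift u.

Record pre_joyce (Om : form2 M) (h : lift_map M) : Prop := {
  pj_symplectic_form : symplectic_form Om;
  pj_connection : connection h;
  pj_flat : forall eps, eps != 0 -> flat_conn (rel_conn_eps h eps);
  pj_symplectic : forall eps, eps != 0 ->
    symplectic_conn Om (rel_conn_eps h eps) }.

(* Omega^{-1} on T*M, through the isomorphism u |-> Om(u, -). *)
Definition sharp (Om : form2 M) (p : M) (a : Cvec R n -> R[i]) : Cvec R n :=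
  get [set u | forall v, Om p u v = a v].

Definition Om_inv (Om : form2 M) (p : M) (a b : Cvec R n -> R[i]) : R[i] :=
  Om p (sharp Om p a) (sharp Om p b).

Definition dual_lattice (L : set (Cvec R n)) : set (Cvec R n -> R[i]) :=
  [set a | linear a /\ forall x, L x -> is_int (a x)].

Definition translation (s : vfield M) (w : tangent M) : tangent M :=
  (w.1, w.2 + two_pi_i *: s w.1).

Definition fibre_opp (w : tangent M) : tangent M := (w.1, - w.2).

Record joyce_structure (Om : form2 M) (Gam : M -> set (Cvec R n))
    (nab : christoffel M) (Z : vfield M) (h : lift_map M) : Prop := {
  js_pre : pre_joyce Om h;
  js_period : period_structure Gam nab Z;
  js_J1 : forall p a b, dual_lattice (Gam p) a -> dual_lattice (Gam p) b ->
    is_int (two_pi_i^-1 * Om_inv Om p a b);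
  js_J2 : forall U s, local_section Gam U s ->
    forall (w : tangent M) u, U (tproj w) ->
    tmap (translation s) w (h w u) = h (translation s w) u;
  js_J3 : forall X, hol_vf setT X -> forall w,
    hlift h (bracket Z X) w =
    bracket (hlift (ehresmann nab) Z) (hlift h X) w;
  js_J4 : forall (w : tangent M) u,
    tmap fibre_opp w (h w u) = h (fibre_opp w) u }.

Definition flat_darboux (Om : form2 M) (nab : christoffel M)
    (c : chart R M n) : Prop :=
  [/\ local_coordinates c,
      forall i (V : set M) (X Y : vfield M), open_in V -> V `<=` dom c ->
        hol_vf V X -> hol_vf V Y -> forall p, V p ->
        cov_form nab X (dfun (fun q => fwd c q 0 i)) Y p = 0 &
      forall i j, exists om : R[i], forall p, dom c p ->
        Om p (coord_vf c i p) (coord_vf c j p) = om].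

End Joyce.

(* An element of eps^-1 V[[eps]] is a sequence nat -> V whose k-th entry is the
   coefficient of eps^(k-1); an element g of Lie(G^) is indexed by the true
   powers of eps, so that its entry g 0 vanishes. *)
Definition Lie_Ghat {R : realType} {n : nat} (M : charted R n)
    (g : nat -> vfield (tangent M)) : Prop :=
  g 0%N = (fun=> 0) /\
  forall k, hol_vf setT (g k) /\
    forall w, tmap (@tproj _ _ M) w (g k w) = 0.

Section Series.
Context {R : realType} {T S : Type} {V : lmodType R[i]}.

Definition ser_op (op : S -> (T -> V) -> (T -> V)) (a : nat -> S)
    (y : nat -> T -> V) (k : nat) : T -> V :=
  fun w => \sum_(i < k.+1) op (a i) (y (k - i)%N) w.

(* The series exp(op g) y = sum_m (op g)^m y / m!.  As g has no term of order 0,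
   (op g)^m raises the order by m and only m <= k contributes to entry k. *)
Definition ser_exp (op : S -> (T -> V) -> (T -> V)) (g : nat -> S)
    (y : nat -> T -> V) (k : nat) : T -> V :=
  fun w => \sum_(m < k.+1) (m`!%:R)^-1 *: iter m (ser_op op g) y k w.

End Series.

Section Formal.
Context {R : realType} {n : nat} (M : charted R n).

(* The lift (eps^-1 v + h)_X of X by a formal relative connection. *)
Definition formal_lift (h : lift_map M) (X : vfield M) (k : nat) :
    vfield (tangent M) :=
  match k with
  | 0 => fun w => vlift (X (tproj w))
  | 1 => hlift h X
  | _ => fun=> 0
  end.

(* e^(L_g) A_h = A_h' *)
Definition gauge_equiv (g : nat -> vfield (tangent M)) (h h' : lift_map M) :
    Prop :=
  forall (U : set M) (X : vfield M), open_in U -> hol_vf U X ->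
  forall k (w : tangent M), U (tproj w) ->
  ser_exp (@bracket _ _ (tangent M)) g (formal_lift h X) k w =
  formal_lift h' X k w.

(* x^(i,st) = theta^i - eps^-1 Z^i *)
Definition x_st (c : chart R M n) (i : 'I_n) (k : nat) :
    tangent M -> R[i] :=
  match k with
  | 0 => fun w => - fwd (tchart c) w 0 (lshift n i)
  | 1 => fun w => fwd (tchart c) w 0 (rshift n i)
  | _ => fun=> 0
  end.

Definition x_coord (g : nat -> vfield (tangent M)) (c : chart R M n)
    (i : 'I_n) : nat -> tangent M -> R[i] :=
  ser_exp (@vact _ _ (tangent M)) g (x_st c i).

End Formal.

(* Main.v *)
From HB Require Import structures.
Require Import Defs.
From mathcomp Require Import landau zify ring lra.

Set Implicit Arguments.
Unset Strict Implicit.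
Unset Printing Implicit Defensive.

Local Open Scope classical_set_scope.
Local Open Scope complex_scope.
Local Open Scope ring_scope.

(** The series of fields [g] acts as a derivation in two ways: on series of
    functions, and by bracket on series of vector fields. Because
    [[g, A] y = g (A y) - A (g y)], bracketing with [g] is a derivation of the
    pairing of a field with a function, so that the two exponentials satisfy
    [e^(L_g) A (e^g y) = e^g (A y)] ([ser_exp_act]). Take for [A] the trivial
    formal connection along a coordinate field and for [y] the function [x_st]:
    the hypothesis on [g] turns [e^(L_g) A] into the formal connection of [h],
    and [e^g y] is [x_coord]. It remains to see that [A y] vanishes, that is,
    that in the coordinates of the total space the vertical lift of [d/dZ^j] is
    [d/dtheta^j] and, since the coordinates are flat, its horizontal lift is
    [d/dZ^j]: then [A y] consists of two Kronecker deltas, of opposite signs and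
    in the same order.

    All of this takes place on the open set over the chart domain, and each
    field and function has to be known to be holomorphic there. The analytic
    input is the identity [vact_bracket], [[X, Y] f = X (Y f) - Y (X f)], which
    rests on the symmetry of second differentials ([Df_sym]). That symmetry is
    proved by the second-difference argument: the mean value theorem is applied
    to real parts along real lines, and imaginary parts are real parts of the
    function multiplied by ['i]. Since holomorphic fields are exactly those
    whose components are holomorphic functions, [vact_bracket] also shows that
    brackets are holomorphic without computing how they transform between
    charts. On the total space of the tangent bundle, the transition maps are
    the tangent maps of those of the base ([tangent_trans]); their differential
    ([Df_tangent_trans]) contains the second derivative of the base transition,
    which flatness identifies with the Christoffel tensor
    ([flat_christoffel]). *)

(** * Differentials *)

Section Differentials.
Context {K : numFieldType} {V W : normedModType K}.

Fact Df_key : unit. Proof. exact: tt. Qed.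

(** A locked copy of ['d f x v]. The term behind ['d] carries the whole chain of
    structures on [R[i]]; locking it keeps unification from unfolding them. *)
Definition Df (f : V -> W) (x v : V) : W := locked_with Df_key ('d f x v).

Lemma DfE (f : V -> W) x v : 'd f x v = Df f x v.
Proof. by rewrite /Df locked_withE. Qed.

Lemma DfD (f : V -> W) x u v : Df f x (u + v) = Df f x u + Df f x v.
Proof. by rewrite -!DfE linearD. Qed.

Lemma DfZ (f : V -> W) x a u : Df f x (a *: u) = a *: Df f x u.
Proof. by rewrite -!DfE linearZ. Qed.

Lemma DfB (f : V -> W) x u v : Df f x (u - v) = Df f x u - Df f x v.
Proof. by rewrite -!DfE linearB. Qed.

Lemma DfN (f : V -> W) x u : Df f x (- u) = - Df f x u.
Proof. by rewrite -!DfE linearN. Qed.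

Lemma Df0 (f : V -> W) x : Df f x 0 = 0.
Proof. by rewrite -!DfE linear0. Qed.

Lemma Df_sumr (f : V -> W) x m (u : 'I_m -> V) :
  Df f x (\sum_i u i) = \sum_i Df f x (u i).
Proof. by rewrite -DfE linear_sum; apply: eq_bigr => i _; rewrite DfE. Qed.

(** Differentiability travels with the value of the differential, as ['d f x] is
    an arbitrary linear map where [f] is not differentiable. *)
Definition has_df (f : V -> W) (x : V) (d : V -> W) :=
  differentiable f x /\ forall v, Df f x v = d v.

Lemma has_df_of (f : V -> W) x (d : V -> W) :
  differentiable f x -> 'd f x = d :> (V -> W) -> has_df f x d.
Proof.
move=> fx E; split=> // v; rewrite -DfE.
exact: (congr1 (fun k : V -> W => k v) E).
Qed.

(** Differentiability and the differential only depend on the germ. The library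
    chooses the differential by a description, so the claim goes through the
    first-order expansion and the uniqueness of its linear part. *)
Lemma has_df_near (f g : V -> W) (x : V) :
  (\forall y \near x, f y = g y) -> differentiable f x ->
  has_df g x (Df f x).
Proof.
move=> fg df.
have fgx : f x = g x by exact: nbhs_singleton fg.
have [dfc dfE] := (diff_locallyP x f).1 df.
have gE : g \o shift x = cst (g x) + 'd f x +o_ 0 id.
  apply/eqaddoP => e e0.
  have /eqaddoP/(_ e e0) dfE' := dfE.
  have fg0 : \forall h \near 0, f (h + x) = g (h + x).
    by move: fg; rewrite (near_shift 0) subr0.
  apply: filterS2 dfE' fg0 => h /= + fgh.
  rewrite -[(f \o shift x - _) h]/(f (h + x) - (f x + 'd f x h)).
  by rewrite -[(g \o shift x - _) h]/(g (h + x) - (g x + 'd f x h)) fgh fgx.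
have gd : 'd g x = 'd f x :> (V -> W) by exact: diff_unique.
have gD : differentiable g x by apply/diff_locallyP; rewrite gd; split.
split=> [//|v]; rewrite -(DfE g) -(DfE f).
exact: (congr1 (fun k : V -> W => k v) gd).
Qed.

Lemma has_df_cst (a : W) x : has_df (fun=> a) x (fun=> 0).
Proof. by apply: has_df_of; [exact: differentiable_cst|rewrite diff_cst]. Qed.

Lemma has_dfD (f g : V -> W) x : differentiable f x -> differentiable g x ->
  has_df (fun y => f y + g y) x (fun v => Df f x v + Df g x v).
Proof.
move=> df dg; apply: has_df_of; first exact: differentiableD.
by rewrite diffD //; apply/funext => v; rewrite /= (DfE f) (DfE g).
Qed.

Lemma has_dfN (f : V -> W) x : differentiable f x ->
  has_df (fun y => - f y) x (fun v => - Df f x v).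
Proof.
move=> df; apply: has_df_of; first exact: differentiableN.
by rewrite diffN //; apply/funext => v; rewrite -DfE.
Qed.

Lemma has_df_sum m (f : 'I_m -> V -> W) x :
  (forall i, differentiable (f i) x) ->
  has_df (fun y => \sum_i f i y) x (fun v => \sum_i Df (f i) x v).
Proof.
elim: m f => [f _|m IH f df].
  have [h1 h2] := has_df_cst 0 x.
  rewrite (_ : (fun y => _) = fun=> 0); last first.
    by apply/funext => y; rewrite big_ord0.
  by split=> // v; rewrite h2 big_ord0.
have [h1 h2] := IH _ (fun i => df (widen_ord (leqnSn m) i)).
have [h3 h4] := has_dfD h1 (df ord_max).
rewrite (_ : (fun y => _) =
  (fun y => \sum_i f (widen_ord (leqnSn m) i) y + f ord_max y)); last first.
  by apply/funext => y; rewrite big_ord_recr.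
by split=> // v; rewrite h4 h2 big_ord_recr.
Qed.

End Differentials.

Section DifferentialsComp.
Context {K : numFieldType} {U V W : normedModType K}.

Lemma has_df_lin (L : {linear V -> W}) x : continuous L -> has_df L x L.
Proof.
by move=> cL; apply: has_df_of; [exact: linear_differentiable|rewrite diff_lin].
Qed.

Lemma has_df_id (x : V) : has_df id x id.
Proof. by case: (is_diff_id x) => h E; exact: has_df_of. Qed.

Lemma has_df_comp (f : U -> V) (g : V -> W) x :
  differentiable f x -> differentiable g (f x) ->
  has_df (fun y => g (f y)) x (fun v => Df g (f x) (Df f x v)).
Proof.
move=> df dg; apply: has_df_of; first exact: differentiable_comp.
apply: etrans (diff_comp df dg) _.
by apply/funext => v; rewrite /= (DfE f) (DfE g).
Qed.

End DifferentialsComp.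

Section DifferentialsShift.
Context {K : numFieldType} {V W : normedModType K}.

Lemma has_df_shift (f : V -> W) (c : V) x : differentiable f (x + c) ->
  has_df (fun y => f (y + c)) x (Df f (x + c)).
Proof.
move=> df; have [d1 E1] := has_df_id x; have [d2 E2] := has_df_cst c x.
have [d3 E3] := has_dfD d1 d2.
have [d4 E4] := has_df_comp d3 df.
by split=> // v; rewrite E4 E3 E1 E2 addr0.
Qed.

(** Leibniz rule, from the differential of the bilinear map [*:%R]. *)
Lemma has_dfZ (a : V -> K) (f : V -> W) x :
  differentiable a x -> differentiable f x ->
  has_df (fun y => a y *: f y) x (fun v => a x *: Df f x v + Df a x v *: f x).
Proof.
move=> da df.
have sbil : bilinear_for (GRing.Scale.Law.clone _ _ *:%R _)
    (GRing.Scale.Law.clone _ _ *:%R _) (@GRing.scale K W).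
  split=> [w|c] t u v /=; first by rewrite scalerDl scalerA.
  by rewrite scalerDr !scalerA mulrC.
pose sB := bilinear_isBilinear.Build K K W W _ _ (@GRing.scale K W) sbil.
pose s : {bilinear K -> W -> W} := HB.pack (@GRing.scale K W) sB.
have sc : continuous (fun p : K * W => s p.1 p.2).
  by move=> p; apply: scale_continuous.
have dp := differentiable_pair da df.
have ds := differentiable_bilin (a x, f x) sc.
apply: has_df_of; first exact: differentiable_comp dp ds.
have /= E := diff_comp dp ds.
rewrite (diff_bilin (a x, f x) sc) (diff_pair da df) in E.
by apply: etrans E _; apply/funext => v; rewrite /= (DfE a) (DfE f).
Qed.

End DifferentialsShift.

(** * Calculus of holomorphic maps *)

Section HolomorphicCalculus.
Context {R : realType}.
Local Notation C := R[i].

Lemma hol_uptoS {n} {W : normedModType C} k (D : set (Cvec R n))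
    (f : Cvec R n -> W) :
  hol_upto k.+1 D f <-> (forall x, D x -> differentiable f x) /\
    forall v, hol_upto k D (fun x => Df f x v).
Proof.
have E v : (fun x => 'd f x v) = (fun x => Df f x v).
  by apply/funext => x; rewrite DfE.
by split=> -[df hf]; split=> // v; [rewrite -E|rewrite E]; exact: hf.
Qed.

Lemma hol_uptoW {n} {W : normedModType C} k (D : set (Cvec R n))
  (f : Cvec R n -> W) : hol_upto k.+1 D f -> hol_upto k D f.
Proof.
elim: k f => [//|k IH] f /hol_uptoS[df hf]; apply/hol_uptoS.
by split=> // v; exact: IH (hf v).
Qed.

Lemma open_near {n} (D : set (Cvec R n)) x : open D -> D x ->
  \forall y \near x, D y.
Proof. by move=> oD Dx; apply: open_nbhs_nbhs. Qed.

Lemma hol_sub {n} {W : normedModType C} (D D' : set (Cvec R n))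
  (f : Cvec R n -> W) : D' `<=` D -> hol D f -> hol D' f.
Proof.
move=> sD hf k; move: (hf k); elim: k f {hf} => [//|k IH] f.
move=> /hol_uptoS[df hf]; apply/hol_uptoS; split=> [x /sD /df //|v].
exact: IH (hf v).
Qed.

Section OnOpenSet.
Context {n : nat} (D : set (Cvec R n)) (oD : open D).

Lemma has_df_eq_on {W : normedModType C} (f g : Cvec R n -> W) x :
  (forall x, D x -> f x = g x) -> D x -> differentiable f x ->
  has_df g x (Df f x).
Proof.
move=> fg Dx; apply: has_df_near.
by apply: filterS (open_near oD Dx) => y; exact: fg.
Qed.

Lemma hol_upto_ext {W : normedModType C} k (f g : Cvec R n -> W) :
  (forall x, D x -> f x = g x) -> hol_upto k D f -> hol_upto k D g.
Proof.
elim: k f g => [//|k IH] f g fg /hol_uptoS[df hf]; apply/hol_uptoS.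
have key x (Dx : D x) := has_df_eq_on fg Dx (df x Dx).
split=> [x Dx|v]; first by have [] := key x Dx.
apply: IH (hf v) => x Dx.
by have [_ E] := key x Dx; rewrite E.
Qed.

Lemma hol_upto_cst {W : normedModType C} k (a : W) : hol_upto k D (fun=> a).
Proof.
elim: k a => [//|k IH] a; apply/hol_uptoS.
have key (x : Cvec R n) := has_df_cst a x.
split=> [x _|v]; first by have [] := key x.
by apply: hol_upto_ext (IH 0) => x _; have [_ E] := key x; rewrite E.
Qed.

Lemma hol_uptoD {W : normedModType C} k (f g : Cvec R n -> W) :
  hol_upto k D f -> hol_upto k D g -> hol_upto k D (fun x => f x + g x).
Proof.
elim: k f g => [//|k IH] f g /hol_uptoS[df hf] /hol_uptoS[dg hg].
apply/hol_uptoS.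
have key x (Dx : D x) := has_dfD (df x Dx) (dg x Dx).
split=> [x Dx|v]; first by have [] := key x Dx.
apply: hol_upto_ext (IH _ _ (hf v) (hg v)) => x Dx.
by have [_ E] := key x Dx; rewrite E.
Qed.

Lemma hol_uptoZ {W : normedModType C} k (a : Cvec R n -> C)
    (f : Cvec R n -> W) :
  hol_upto k D a -> hol_upto k D f -> hol_upto k D (fun x => a x *: f x).
Proof.
elim: k a f => [//|k IH] a f ha hf.
have [/hol_uptoS[da ha'] /hol_uptoS[df hf']] := (ha, hf).
apply/hol_uptoS.
have key x (Dx : D x) := has_dfZ (da x Dx) (df x Dx).
split=> [x Dx|v]; first by have [] := key x Dx.
apply: hol_upto_ext (hol_uptoD (IH _ _ (hol_uptoW ha) (hf' v))
  (IH _ _ (ha' v) (hol_uptoW hf))) => x Dx.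
by have [_ E] := key x Dx; rewrite E.
Qed.

Lemma hol_upto_sum {W : normedModType C} k m (f : 'I_m -> Cvec R n -> W) :
  (forall i, hol_upto k D (f i)) -> hol_upto k D (fun x => \sum_i f i x).
Proof.
elim: m f => [f _|m IH f hf].
  by apply: hol_upto_ext (hol_upto_cst _ 0) => x _; rewrite big_ord0.
apply: hol_upto_ext (hol_uptoD (IH _ (fun i => hf (widen_ord (leqnSn m) i)))
  (hf ord_max)) => x _.
by rewrite big_ord_recr.
Qed.

Lemma has_df_coord m (f : Cvec R n -> Cvec R m) i x :
  differentiable f x -> has_df (fun y => f y 0 i) x (fun v => Df f x v 0 i).
Proof.
move=> df.
pose L : Cvec R m -> C := fun x => x 0 i.
have Llin : linear L by move=> a y z; rewrite /L !mxE.
pose LM := GRing.isLinear.Build _ _ _ _ _ Llin.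
pose LL : {linear _ -> _} := HB.pack L LM.
have cL : continuous LL by exact: coord_continuous.
have [dL LE] := has_df_lin (f x) cL.
have [dc cE] := has_df_comp df dL.
by split=> [//|v]; apply: etrans (cE v) (LE _).
Qed.

Lemma hol_upto_coord k m (f : Cvec R n -> Cvec R m) i :
  hol_upto k D f -> hol_upto k D (fun x => f x 0 i).
Proof.
elim: k f => [//|k IH] f /hol_uptoS[df hf]; apply/hol_uptoS.
have key x (Dx : D x) := has_df_coord i (df x Dx).
split=> [x Dx|v]; first by have [] := key x Dx.
apply: hol_upto_ext (IH _ (hf v)) => x Dx.
by have [_ E] := key x Dx; rewrite E.
Qed.

(** Reduces vector-valued maps to scalar-valued ones, through the expansion in
    the canonical basis. *)
Lemma hol_upto_row k m (f : Cvec R n -> Cvec R m) :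
  (forall i, hol_upto k D (fun x => f x 0 i)) -> hol_upto k D f.
Proof.
move=> hf; apply: hol_upto_ext (hol_upto_sum (fun i =>
  hol_uptoZ (hf i) (hol_upto_cst k (delta_mx 0 i)))) => x _.
by rewrite -row_sum_delta.
Qed.

Lemma hol_upto_id k : hol_upto k D id.
Proof.
case: k => // k; apply/hol_uptoS; split=> [x _|v].
  by have [] := has_df_id x.
apply: hol_upto_ext (hol_upto_cst k v) => x _.
by have [_ E] := has_df_id x; rewrite E.
Qed.

End OnOpenSet.

(** Lets a varying direction be treated as scalar coefficients of finitely many
    fixed directions, the only ones that [hol] speaks of. *)
Lemma Df_sum_delta {n} {W : normedModType C} (f : Cvec R n -> W) x v :
  Df f x v = \sum_i v 0 i *: Df f x (delta_mx 0 i).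
Proof.
rewrite {1}(row_sum_delta v) Df_sumr; apply: eq_bigr => i _; exact: DfZ.
Qed.

Lemma hol_upto_comp {n m} {W : normedModType C} k (D : set (Cvec R n))
    (E : set (Cvec R m)) (f : Cvec R n -> Cvec R m) (g : Cvec R m -> W) :
  open D -> open E -> (forall x, D x -> E (f x)) ->
  hol_upto k D f -> hol_upto k E g -> hol_upto k D (fun x => g (f x)).
Proof.
move=> oD oE DE; elim: k f g DE => [//|k IH] f g DE hf hg.
have [/hol_uptoS[df hf'] /hol_uptoS[dg hg']] := (hf, hg).
apply/hol_uptoS.
have key x (Dx : D x) := has_df_comp (df x Dx) (dg _ (DE x Dx)).
split=> [x Dx|v]; first by have [] := key x Dx.
have hs i : hol_upto k D (fun x => (Df f x v) 0 i *: Df g (f x) (delta_mx 0 i)).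
  apply: (hol_uptoZ oD); first by apply: (hol_upto_coord oD); exact: hf'.
  by apply: (IH f (fun y => Df g y (delta_mx 0 i)) DE) => //; exact: hol_uptoW.
apply: (hol_upto_ext oD) (hol_upto_sum oD hs) => x Dx.
by have [_ e] := key x Dx; rewrite e -Df_sum_delta.
Qed.

Section HolFunctions.
Context {n : nat} (D : set (Cvec R n)) (oD : open D).

Lemma hol_ext {W : normedModType C} (f g : Cvec R n -> W) :
  (forall x, D x -> f x = g x) -> hol D f -> hol D g.
Proof. by move=> fg hf k; apply: (hol_upto_ext oD) (hf k). Qed.

Lemma hol_differentiable {W : normedModType C} (f : Cvec R n -> W) x :
  hol D f -> D x -> differentiable f x.
Proof. by move=> hf; have /hol_uptoS[df _] := hf 1%N; exact: df. Qed.

Lemma hol_Df {W : normedModType C} (f : Cvec R n -> W) v :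
  hol D f -> hol D (fun x => Df f x v).
Proof. by move=> hf k; have /hol_uptoS[_] := hf k.+1; exact. Qed.

Lemma hol_cst {W : normedModType C} (a : W) : hol D (fun=> a).
Proof. by move=> k; exact: hol_upto_cst. Qed.

Lemma holD {W : normedModType C} (f g : Cvec R n -> W) :
  hol D f -> hol D g -> hol D (fun x => f x + g x).
Proof. by move=> hf hg k; exact: hol_uptoD. Qed.

Lemma holZ {W : normedModType C} (a : Cvec R n -> C) (f : Cvec R n -> W) :
  hol D a -> hol D f -> hol D (fun x => a x *: f x).
Proof. by move=> hf hg k; exact: hol_uptoZ. Qed.

Lemma hol_sum {W : normedModType C} m (f : 'I_m -> Cvec R n -> W) :
  (forall i, hol D (f i)) -> hol D (fun x => \sum_i f i x).
Proof. by move=> hf k; apply: hol_upto_sum => // i; exact: hf. Qed.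

Lemma hol_rowP m (f : Cvec R n -> Cvec R m) :
  hol D f <-> forall i, hol D (fun x => f x 0 i).
Proof.
split=> [hf i k|hf k]; first exact: hol_upto_coord.
by apply: hol_upto_row => // i; exact: hf.
Qed.

Lemma hol_id : hol D id.
Proof. by move=> k; exact: hol_upto_id. Qed.

Lemma hol_comp {m} {W : normedModType C} (E : set (Cvec R m))
    (f : Cvec R n -> Cvec R m) (g : Cvec R m -> W) :
  open E -> (forall x, D x -> E (f x)) ->
  hol D f -> hol E g -> hol D (fun x => g (f x)).
Proof. by move=> oE DE hf hg k; apply: hol_upto_comp (hf k) (hg k). Qed.

End HolFunctions.

Section DifferentialAlongMap.
Context {n : nat} (D : set (Cvec R n)) (oD : open D).

Lemma hol_Df_comp {m} {W : normedModType C} (E : set (Cvec R m))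
    (f : Cvec R m -> W) (a Y : Cvec R n -> Cvec R m) :
  open E -> (forall x, D x -> E (a x)) -> hol E f -> hol D a -> hol D Y ->
  hol D (fun x => Df f (a x) (Y x)).
Proof.
move=> oE DE hf ha /(hol_rowP oD) hY.
apply: (hol_ext oD) (hol_sum oD (fun i => holZ oD (hY i)
  (hol_comp oD oE DE ha (hol_Df (delta_mx 0 i) hf)))).
by move=> x _; rewrite -Df_sum_delta.
Qed.

(** Leibniz rule for the pairing of a differential with a varying vector. It
    yields both the second derivative in [vact_vact] and the differential of a
    tangent map. *)
Lemma Df_Df_comp {m} {W : normedModType C} (E : set (Cvec R m))
    (f : Cvec R m -> W) (a Y : Cvec R n -> Cvec R m) x u :
  E (a x) -> hol E f -> hol D a -> hol D Y -> D x ->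
  Df (fun y => Df f (a y) (Y y)) x u =
  Df (fun y => Df f y (Y x)) (a x) (Df a x u) + Df f (a x) (Df Y x u).
Proof.
move=> Ex hf ha hY Dx.
have dY : differentiable Y x by exact: hol_differentiable.
have da : differentiable a x by exact: hol_differentiable.
have dg i := hol_differentiable (hol_Df (delta_mx 0 i) hf) Ex.
have dc i := has_df_comp da (dg i).
have dt i := has_dfZ (has_df_coord i dY).1 (dc i).1.
have [_ E1] := has_df_sum (fun i => (dt i).1).
rewrite (_ : (fun y => Df f (a y) (Y y)) =
  (fun y => \sum_i Y y 0 i *: Df f (a y) (delta_mx 0 i))); last first.
  by apply/funext => y; exact: Df_sum_delta.
have dk i := has_dfZ (has_df_cst (Y x 0 i) (a x)).1 (dg i).
have [_ E2] := has_df_sum (fun i => (dk i).1).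
rewrite (_ : (fun y => Df f y (Y x)) =
  (fun y => \sum_i Y x 0 i *: Df f y (delta_mx 0 i))); last first.
  by apply/funext => y; exact: Df_sum_delta.
apply: etrans (E1 u) _.
rewrite [X in _ = _ + X]Df_sum_delta.
apply: etrans _ (congr2 +%R (esym (E2 _)) erefl).
rewrite -big_split; apply: eq_bigr => i _ /=.
have [_ F1] := dt i; apply: etrans (F1 u) _.
have [_ F2] := has_df_coord i dY; rewrite (F2 u).
have [_ F3] := dk i.
apply: (congr2 +%R) => //.
have [_ F4] := has_df_cst (Y x 0 i) (a x).
apply: etrans _ (esym (F3 _)); rewrite F4 scale0r addr0; congr (_ *: _).
by have [_ F5] := dc i; exact: F5.
Qed.

End DifferentialAlongMap.
End HolomorphicCalculus.

(** * Symmetry of second differentials *)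

Section Schwarz.
Context {R : realType}.
Local Notation C := R[i].

Lemma realC (z : C) : 0 <= z -> exists2 r : R, 0 <= r & z = r%:C.
Proof.
move=> z0; exists (complex.Re z); first by move: z0; rewrite lecE => /andP[].
by rewrite RRe_real // ger0_real.
Qed.

Lemma normV_real {V : normedModType C} (x : V) :
  exists2 r : R, 0 <= r & `|x| = r%:C.
Proof. exact: realC. Qed.

(** Radii over [R[i]] are complex numbers; this makes them real. *)
Lemma nbhs_real {V : normedModType C} (x : V) (P : set V) :
  (\forall y \near x, P y) ->
  exists2 d : R, 0 < d & forall k, `|k| < d%:C -> P (k + x).
Proof.
move=> /nbhs_normP[e /= e0 eP].
have [d _ ed] := realC (ltW e0).
exists d; first by move: e0; rewrite ed ltcR.
by move=> k kd; apply: eP; rewrite /= opprD addrCA subrr addr0 normrN ed.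
Qed.

Lemma differentiable_eps {V W : normedModType C} (f : V -> W) x (e : R) :
  differentiable f x -> 0 < e -> exists2 d : R, 0 < d &
  forall k, `|k| < d%:C -> `|f (x + k) - f x - Df f x k| <= e%:C * `|k|.
Proof.
move=> /diff_locally /eqaddoP /(_ e%:C) + e0.
rewrite ltcR => /(_ e0) /nbhs_real [d d0 dP].
exists d => // k kd; have := dP k kd; rewrite addr0.
rewrite -[(f \o shift x - _) k]/(f (k + x) - (f x + 'd f x k)).
by rewrite opprD addrA DfE (addrC k).
Qed.

Lemma Re_le_norm (z : C) (r : R) : `|z| <= r%:C -> `|complex.Re z| <= r.
Proof.
by move=> zr; have := le_trans (normc_ge_Re z) zr; rewrite lecR.
Qed.

Lemma ReZ (t : R) (z : C) : complex.Re (t%:C * z) = t * complex.Re z.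
Proof. by case: z => a b /=; rewrite mul0r subr0. Qed.

Lemma ReB (z w : C) : complex.Re (z - w) = complex.Re z - complex.Re w.
Proof. by case: z; case: w. Qed.

Lemma ReD (z w : C) : complex.Re (z + w) = complex.Re z + complex.Re w.
Proof. by case: z; case: w. Qed.

Lemma norm_realZ {V : normedModType C} (t : R) (u : V) :
  `|t%:C *: u| = `|t|%:C * `|u|.
Proof.
by rewrite normrZ normc_def /= expr0n /= addr0 sqrtr_sqr.
Qed.

(** A complex differential gives real derivatives along real lines, so that the
    real mean value theorem applies to real parts. *)
Lemma is_derive_Re_line {V : normedModType C} (f : V -> C) p u (s : R) :
  differentiable f (p + s%:C *: u) ->
  is_derive s 1 (fun s : R => complex.Re (f (p + s%:C *: u)))
    (complex.Re (Df f (p + s%:C *: u) u)).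
Proof.
move=> df; set q := p + _ in df *; set l := complex.Re _.
have [nu nu0 nuE] := normV_real u.
suff cv : (fun h : R => h^-1 *: (complex.Re (f (p + (h *: 1 + s)%:C *: u))
    - complex.Re (f q))) @ 0^' --> l.
  split; last exact: cvg_lim cv.
  by apply: cvgP cv.
apply/cvgrPdist_le => e e0.
have e'0 : 0 < e / (nu + 1) by apply: divr_gt0 => //; lra.
have [d d0 dP] := differentiable_eps df e'0.
have d'0 : 0 < d / (nu + 1) by apply: divr_gt0 => //; lra.
near=> h.
have h0 : h != 0 by near: h; exact: nbhs_dnbhs_neq.
have hd : `|h| < d / (nu + 1) by near: h; exact: dnbhs0_lt.
have hd' : `|h| * (nu + 1) < d by rewrite -ltr_pdivlMr //; lra.
have nu1 : 0 <= `|h| by [].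
have hu : `|h%:C *: u| < d%:C.
  by rewrite norm_realZ nuE -rmorphM ltcR; nra.
have := dP _ hu; rewrite norm_realZ nuE -!rmorphM => /Re_le_norm E.
have qE : q + h%:C *: u = p + (h *: 1 + s)%:C *: u.
  by rewrite /q -addrA [_%:C *: u + _]addrC -scalerDl -rmorphD /= [h *: 1]mulr1.
rewrite qE DfZ !raddfB /= ReZ -/l in E.
set X := complex.Re _ in E *; set Y := complex.Re _ in E *.
rewrite -(@ler_pM2l _ `|h|) ?normr_gt0 // -normrM mulrBr.
rewrite [h * (_ *: _)]mulrA divff // mul1r distrC.
apply: le_trans E _.
rewrite mulrCA ler_wpM2l // -mulrA ler_piMr //; first exact: ltW.
rewrite mulrC ler_pdivrMr; lra.
Unshelve. all: by end_near. Qed.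

Lemma Re_mvt {V : normedModType C} (f : V -> C) p u (t : R) : 0 < t ->
  (forall s : R, 0 <= s <= t -> differentiable f (p + s%:C *: u)) ->
  exists2 s : R, 0 < s < t &
  complex.Re (f (p + t%:C *: u)) - complex.Re (f p) =
  t * complex.Re (Df f (p + s%:C *: u) u).
Proof.
move=> t0 df.
have dl s : 0 <= s <= t -> is_derive s 1 _ _ :=
  fun hs => is_derive_Re_line (df s hs).
have din s : s \in `]0, t[%R -> 0 <= s <= t.
  by rewrite in_itv /= => /andP[/ltW -> /ltW ->].
have cont : {within `[0, t], continuous
    (fun s : R => complex.Re (f (p + s%:C *: u)))}.
  apply: derivable_within_continuous => x; rewrite in_itv /= => hx.
  by have [] := dl x hx.
have [s st E] := MVT t0 (fun s hs => dl s (din s hs)) cont.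
exists s; first by move: st; rewrite in_itv.
by move: E; rewrite scale0r addr0 subr0 mulrC.
Qed.

Lemma second_difference_arith (P P1 P2 P3 A0 A1 A2 Lu Lv e e' a b s t : R) :
  0 < t -> 0 < s < t -> 0 <= a -> 0 <= b -> 0 < e' ->
  e' * (2 * a + b + 1) = e ->
  P - P1 - (P2 - P3) = t * (A1 - A2) ->
  `|A1 - A0 - (s * Lu + t * Lv)| <= e' * (s * a + t * b) ->
  `|A2 - A0 - (s * Lu + 0 * Lv)| <= e' * (s * a + 0 * b) ->
  `|P - P2 - P1 + P3 - t ^+ 2 * Lv| <= t ^+ 2 * e.
Proof.
move=> t0 /andP[s0 st] a0 b0 e'0 eE E /ler_normlP[b1 b2] /ler_normlP[b3 b4].
have key : `|A1 - A2 - t * Lv| <= t * e.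
  have ie : e' * (s * a + t * b) + e' * (s * a) <= t * e.
    have sa : s * a <= t * a by rewrite ler_wpM2r // ltW.
    rewrite -eE -mulrDr mulrCA ler_wpM2l ?(ltW e'0) //; nra.
  by apply/ler_normlP; split; lra.
have -> : P - P2 - P1 + P3 - t ^+ 2 * Lv = t * (A1 - A2 - t * Lv) by nra.
by rewrite normrM (gtr0_norm t0) expr2 -mulrA ler_pM2l.
Qed.

(** The second difference of [f] along [u] and [v], divided by [t ^ 2], tends to
    the derivative along [v] of the derivative along [u]: apply the mean value
    theorem to [f (y + t v) - f y] along [u], then expand the derivative along
    [u] to first order at [x]. *)
Lemma second_difference n (D : set (Cvec R n)) (f : Cvec R n -> C) x u v
    (e : R) :
  open D -> hol D f -> D x -> 0 < e ->
  exists2 d : R, 0 < d & forall t : R, 0 < t < d ->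
  `|complex.Re (f (x + t%:C *: u + t%:C *: v) - f (x + t%:C *: v)
       - f (x + t%:C *: u) + f x)
    - t ^+ 2 * complex.Re (Df (fun y => Df f y u) x v)| <= t ^+ 2 * e.
Proof.
move=> oD hf Dx e0.
have [a a0 aE] := normV_real u; have [b b0 bE] := normV_real v.
have ab : 0 < 2 * a + b + 1 by lra.
(* The expansion of [Df f _ u] is used at two points, at distance at most
   [t * (a + b)] and [t * a] from [x]; the errors add up. *)
have e'0 : 0 < e / (2 * a + b + 1) by exact: divr_gt0.
have df y : D y -> differentiable f y by exact: hol_differentiable.
have [d1 d10 dP1] :=
  differentiable_eps (hol_differentiable (hol_Df u hf) Dx) e'0.
have [d2 d20 dP2] := nbhs_real (open_near oD Dx).
pose d := Num.min d1 d2.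
have d0 : 0 < d by rewrite lt_min d10.
exists (d / (2 * a + b + 1)); first exact: divr_gt0.
move=> t /andP[t0]; rewrite ltr_pdivlMr // => td.
have small r s : 0 <= r <= t -> 0 <= s <= t ->
    `|r%:C *: u + s%:C *: v| < d%:C.
  move=> /andP[r0 rt] /andP[s0 st].
  apply: (le_lt_trans (ler_normD _ _)).
  rewrite !norm_realZ aE bE -!rmorphM -rmorphD ltcR !ger0_norm //.
  by apply: le_lt_trans td; nra.
have inD r s : 0 <= r <= t -> 0 <= s <= t -> D (x + r%:C *: u + s%:C *: v).
  move=> hr hs; rewrite -addrA addrC; apply: dP2.
  by apply: lt_le_trans (small _ _ hr hs) _; rewrite lecR ge_min lexx orbT.
have tt : 0 <= t <= t by rewrite lexx ltW.
have t00 : 0 <= (0 : R) <= t by rewrite lexx ltW.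
pose F y := f (y + t%:C *: v) - f y.
have dF (s : R) : 0 <= s <= t -> has_df F (x + s%:C *: u)
    (fun w => Df f (x + s%:C *: u + t%:C *: v) w - Df f (x + s%:C *: u) w).
  move=> hs.
  have D1 := inD s t hs tt; have D2 := inD s 0 hs t00.
  rewrite scale0r addr0 in D2.
  have [d3 E3] := has_df_shift (df _ D1); have [d4 E4] := has_dfN (df _ D2).
  have [d5 E5] := has_dfD d3 d4.
  split; first exact: d5.
  by move=> w; rewrite E5; apply: (congr2 +%R); [exact: E3|exact: E4].
have [s /andP[s0 st] E] := Re_mvt t0 (fun s hs => (dF s hs).1).
have hs : 0 <= s <= t by rewrite !ltW.
have [_ dFE] := dF s hs; rewrite dFE in E.
rewrite /F !ReB in E.
set e' := e / _ in e'0 dP1.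
have bound r q : 0 <= r <= t -> 0 <= q <= t ->
    `|complex.Re (Df f (x + r%:C *: u + q%:C *: v) u) - complex.Re (Df f x u)
      - (r * complex.Re (Df (fun y => Df f y u) x u)
         + q * complex.Re (Df (fun y => Df f y u) x v))|
    <= e' * (r * a + q * b).
  move=> hr hq; have /andP[r0 _] := hr; have /andP[q0 _] := hq.
  have kd : `|r%:C *: u + q%:C *: v| < d1%:C.
    by apply: lt_le_trans (small _ _ hr hq) _; rewrite lecR ge_min lexx.
  rewrite -!ReZ -!ReB -ReD -ReB; apply: Re_le_norm.
  have := dP1 _ kd; rewrite addrA DfD (DfZ _ _ r%:C) (DfZ _ _ q%:C).
  move=> /le_trans; apply.
  rewrite [leRHS](rmorphM (real_complex R)); apply: ler_wpM2l.
    by rewrite lecR ltW.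
  apply: (le_trans (ler_normD _ _)).
  by rewrite !norm_realZ aE bE -!rmorphM -rmorphD lecR !ger0_norm.
have b1 := bound _ _ hs tt; have b2 := bound _ _ hs t00.
have xE : x + s%:C *: u + 0%:C *: v = x + s%:C *: u by rewrite scale0r addr0.
rewrite xE in b2.
rewrite ReD !ReB.
apply: second_difference_arith E b1 b2 => //; first by rewrite s0.
by rewrite /e' divfK // gt_eqF.
Qed.

Lemma symmetric_limit_arith (P P1 P2 P3 L1 L2 t e : R) : 0 < t ->
  `|P - P1 - P2 + P3 - t ^+ 2 * L1| <= t ^+ 2 * (e / 2) ->
  `|P - P2 - P1 + P3 - t ^+ 2 * L2| <= t ^+ 2 * (e / 2) -> `|L1 - L2| <= e.
Proof.
move=> t0 /ler_normlP[a1 a2] /ler_normlP[a3 a4].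
have tt0 : 0 < t ^+ 2 by rewrite exprn_gt0.
rewrite -(ler_pM2l tt0) -[X in X * `|_|](gtr0_norm tt0) -normrM.
by apply/ler_normlP; split; rewrite mulrBr; lra.
Qed.

(** The second difference does not depend on the order of [u] and [v], hence
    neither does its limit. *)
Lemma Re_Df_sym n (D : set (Cvec R n)) (f : Cvec R n -> C) x u v :
  open D -> hol D f -> D x ->
  complex.Re (Df (fun y => Df f y u) x v) =
  complex.Re (Df (fun y => Df f y v) x u).
Proof.
move=> oD hf Dx; apply/eqP; rewrite -subr_eq0 -normr_le0.
apply/ler_addgt0Pl => e e0; rewrite addr0.
have e20 : 0 < e / 2 by exact: divr_gt0.
have [d1 d10 H1] := second_difference u v oD hf Dx e20.
have [d2 d20 H2] := second_difference v u oD hf Dx e20.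
pose t := Num.min d1 d2 / 2.
have m0 : 0 < Num.min d1 d2 by rewrite lt_min d10.
have t0 : 0 < t by exact: divr_gt0.
have tm : t < Num.min d1 d2 by rewrite /t; lra.
have [t1 t2] : t < d1 /\ t < d2 by move: tm; rewrite lt_min => /andP.
have h1 := H1 t; rewrite t0 t1 in h1; have {}h1 := h1 isT.
have h2 := H2 t; rewrite t0 t2 in h2; have {}h2 := h2 isT.
have xE : x + t%:C *: v + t%:C *: u = x + t%:C *: u + t%:C *: v.
  by rewrite addrAC.
rewrite xE in h2; rewrite ReD !ReB in h1; rewrite ReD !ReB in h2.
exact: symmetric_limit_arith t0 h1 h2.
Qed.

Lemma complex_eq_Re (z w : C) : complex.Re z = complex.Re w ->
  complex.Re ('i%C *: z) = complex.Re ('i%C *: w) -> z = w.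
Proof.
case: z => a b; case: w => c d /= ->.
by rewrite !mul0r !mul1r !sub0r => /oppr_inj ->.
Qed.

(** The imaginary part of [f] is, up to sign, the real part of ['i * f]. *)
Lemma Df_sym n (D : set (Cvec R n)) (f : Cvec R n -> C) x u v :
  open D -> hol D f -> D x ->
  Df (fun y => Df f y u) x v = Df (fun y => Df f y v) x u.
Proof.
move=> oD hf Dx.
have hc : hol D (fun=> 'i%C : C) by exact: hol_cst.
have hif : hol D (fun y => 'i%C *: f y) by exact: holZ.
have scal (g : Cvec R n -> C) y w : hol D g -> D y ->
    Df (fun y => 'i%C *: g y) y w = 'i%C *: Df g y w.
  move=> hg Dy; have [_ E0] := has_df_cst ('i%C : C) y.
  have [_ E] := has_dfZ (hol_differentiable hc Dy) (hol_differentiable hg Dy).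
  by rewrite E E0 scale0r addr0.
have scal2 a b : Df (fun y => Df (fun y => 'i%C *: f y) y a) x b =
    'i%C *: Df (fun y => Df f y a) x b.
  have Ea y : D y -> 'i%C *: Df f y a = Df (fun y => 'i%C *: f y) y a.
    by move=> Dy; rewrite (scal f y a hf Dy).
  have hfa := hol_Df a hf.
  have [_ E] := has_df_eq_on oD Ea Dx
    (hol_differentiable (holZ oD hc hfa) Dx).
  by apply: etrans (E b) _; exact: scal hfa Dx.
have re := Re_Df_sym u v oD hf Dx.
have im := Re_Df_sym u v oD hif Dx; rewrite (scal2 u v) (scal2 v u) in im.
exact: complex_eq_Re re im.
Qed.

End Schwarz.

(** * Functions and vector fields on complex manifolds *)

(** The part of the structure of a complex manifold that local computations
    use. It passes to the total space of the tangent bundle by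
    [tangent_atlas]. *)
Record holomorphic_atlas {R : realType} {n : nat} (N : charted R n) : Prop := {
  ha_pref : forall p, atlas N (pref N p) /\ dom (pref N p) p;
  ha_atlas : forall c, atlas N c -> local_coordinates c }.

Section Charts.
Context {R : realType} {T : Type} {n : nat}.
Implicit Types a b c : chart R T n.

Definition chart_cancel c := forall p, dom c p -> bwd c (fwd c p) = p.

Lemma imgP c (O : set T) x : chart_cancel c -> img c O x ->
  [/\ dom c (bwd c x), O (bwd c x) & fwd c (bwd c x) = x].
Proof. by move=> cc [p [cp Op] <-]; rewrite cc. Qed.

Lemma img_fwd c (O : set T) p : dom c p -> O p -> img c O (fwd c p).
Proof. by move=> cp Op; exists p. Qed.

Lemma imgI c (O P : set T) : chart_cancel c ->
  img c (O `&` P) = img c O `&` img c P.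
Proof.
move=> cc; apply/seteqP; split=> x.
  by case=> p [? [? ?]] <-; split; exists p.
move=> [/(imgP cc)[dx Ox xE] /(imgP cc)[_ Px _]].
by rewrite -xE; exact: img_fwd.
Qed.

Lemma transition_differentiable a b p : chart_cancel a -> compatible a b ->
  dom a p -> dom b p -> differentiable (fwd b \o bwd a) (fwd a p).
Proof.
by move=> ca [oab hab] ap bp; apply: hol_differentiable hab _; exact: img_fwd.
Qed.

(** Cocycle rule for the differentials of the transition maps at one point. *)
Lemma transition_comp a b c p u : chart_cancel a -> chart_cancel b ->
  compatible a b -> compatible b c -> dom a p -> dom b p -> dom c p ->
  Df (fwd c \o bwd b) (fwd b p) (Df (fwd b \o bwd a) (fwd a p) u) =
  Df (fwd c \o bwd a) (fwd a p) u.
Proof.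
move=> ca cb cab cbc ap bp cp.
have d1 := transition_differentiable ca cab ap bp.
have d2 := transition_differentiable cb cbc bp cp.
have pE : (fwd b \o bwd a) (fwd a p) = fwd b p by rewrite /= ca.
rewrite -pE in d2 *.
have [d3 E3] := has_df_comp d1 d2.
have agree x : img a (dom b) x ->
    (fwd c \o bwd b) ((fwd b \o bwd a) x) = (fwd c \o bwd a) x.
  by move=> /(imgP ca)[_ bx _]; rewrite /= cb.
have [_ E] := has_df_eq_on cab.1 agree (img_fwd ap bp) d3.
by apply: etrans (esym (E3 u)) _; exact: esym (E u).
Qed.

Lemma transition_refl a b p u : chart_cancel a -> compatible a b ->
  dom a p -> dom b p -> Df (fwd a \o bwd a) (fwd a p) u = u.
Proof.
move=> ca [oab _] ap bp.
have agree x : img a (dom b) x -> id x = (fwd a \o bwd a) x.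
  by move=> /(imgP ca)[_ _ xE]; rewrite /= xE.
have [d1 E1] := has_df_id (fwd a p).
have [_ E] := has_df_eq_on oab agree (img_fwd ap bp) d1.
exact: etrans (E u) (E1 u).
Qed.

End Charts.

Section Manifold.
Context {R : realType} {n : nat} (N : charted R n) (hN : holomorphic_atlas N).
Implicit Types (c d : chart R N n) (p : N) (O : set N).

Lemma tcoordE c p u :
  tcoord c p u = Df (fwd c \o bwd (pref N p)) (fwd (pref N p) p) u.
Proof. exact: DfE. Qed.

Lemma tvecE c p x : tvec c p x = Df (fwd (pref N p) \o bwd c) (fwd c p) x.
Proof. exact: DfE. Qed.

Lemma dfunE (f : N -> R[i]) p u :
  dfun f p u = Df (f \o bwd (pref N p)) (fwd (pref N p) p) u.
Proof. exact: DfE. Qed.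

Lemma pref_local p : local_coordinates (pref N p).
Proof. by apply: ha_atlas hN _ (ha_pref hN p).1. Qed.

Section LocalChart.
Variables (c : chart R N n) (hc : local_coordinates c).

Lemma local_cancel : chart_cancel c. Proof. exact: hc.1. Qed.

Lemma compat_pref p : compatible c (pref N p) /\ compatible (pref N p) c.
Proof. by have [] := hc.2 _ (ha_pref hN p).1. Qed.

Lemma tvecK p x : dom c p -> tcoord c p (tvec c p x) = x.
Proof.
move=> cp; have [c1 c2] := compat_pref p; have ep := (ha_pref hN p).2.
rewrite tcoordE tvecE.
rewrite (transition_comp x local_cancel (pref_local p).1 c1 c2 cp ep cp).
exact: transition_refl local_cancel c1 cp ep.
Qed.

Lemma tcoordK p u : dom c p -> tvec c p (tcoord c p u) = u.
Proof.
move=> cp; have [c1 c2] := compat_pref p; have ep := (ha_pref hN p).2.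
have ce := (pref_local p).1.
rewrite tcoordE tvecE (transition_comp u ce local_cancel c2 c1 ep cp ep).
exact: transition_refl ce c2 ep cp.
Qed.

Lemma dom_open : open_in (dom c).
Proof. by move=> d Ad; have [_ []] := hc.2 d Ad. Qed.

End LocalChart.

(** Tangent vectors are by convention given in the preferred chart. *)
Lemma tcoord_pref p u : tcoord (pref N p) p u = u.
Proof.
have h := pref_local p; have ep := (ha_pref hN p).2.
rewrite tcoordE; exact: (transition_refl _ h.1 (compat_pref h p).1 ep ep).
Qed.

Lemma tcoord_transition c d p u : local_coordinates c -> compatible c d ->
  dom c p -> dom d p ->
  Df (fwd d \o bwd c) (fwd c p) (tcoord c p u) = tcoord d p u.
Proof.
move=> hc cd cp dp; rewrite !tcoordE.
exact: (transition_comp _ (pref_local p).1 hc.1 (compat_pref hc p).2 cd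
  (ha_pref hN p).2 cp dp).
Qed.

Lemma tcoord_tvec c d p x : local_coordinates c -> compatible c d ->
  dom c p -> dom d p ->
  tcoord d p (tvec c p x) = Df (fwd d \o bwd c) (fwd c p) x.
Proof.
move=> hc cd cp dp.
by rewrite -(tcoord_transition _ hc cd cp dp) (tvecK hc _ cp).
Qed.

Lemma tcoord_sum c p m (u : 'I_m -> Cvec R n) :
  tcoord c p (\sum_i u i) = \sum_i tcoord c p (u i).
Proof. by rewrite tcoordE Df_sumr; apply: eq_bigr => i _; rewrite tcoordE. Qed.

Lemma atlas_compat c d : atlas N c -> atlas N d -> compatible c d.
Proof. by move=> Ac Ad; have [] := (ha_atlas hN Ac).2 d Ad. Qed.

Lemma open_inI O O' : open_in O -> open_in O' -> open_in (O `&` O').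
Proof.
move=> oO oO' c Ac; rewrite imgI; first exact: openI (oO c Ac) (oO' c Ac).
exact: (ha_atlas hN Ac).1.
Qed.

Lemma img_dom c O : img c (O `&` dom c) = img c O.
Proof. by rewrite /img (setIC O) setIA setIid. Qed.

Lemma img_sub c O O' : O' `<=` O -> img c O' `<=` img c O.
Proof. by move=> sO x [p [cp /sO Op] <-]; exists p. Qed.

Lemma hol_fun_sub O O' (f : N -> R[i]) : O' `<=` O -> hol_fun O f ->
  hol_fun O' f.
Proof. by move=> sO hf c Ac; apply: hol_sub (img_sub sO) (hf c Ac). Qed.

Lemma hol_vf_sub O O' (X : vfield N) : O' `<=` O -> hol_vf O X -> hol_vf O' X.
Proof. by move=> sO hf c Ac; apply: hol_sub (img_sub sO) (hf c Ac). Qed.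

Section OnOpenSet.
Variables (O : set N) (oO : open_in O).

(** The differential of a function may be computed in any chart of the atlas,
    although [dfun] refers to the preferred chart, which varies with the point. *)
Lemma dfun_chart (f : N -> R[i]) c p u : hol_fun O f -> atlas N c ->
  O p -> dom c p -> dfun f p u = Df (f \o bwd c) (fwd c p) (tcoord c p u).
Proof.
move=> hf Ac Op cp; rewrite dfunE tcoordE.
set e := pref N p; have [Ae ep] := ha_pref hN p.
have ce : chart_cancel e := (pref_local p).1.
have cc : chart_cancel c := (ha_atlas hN Ac).1.
have d1 := transition_differentiable ce (atlas_compat Ae Ac) ep cp.
have pE : (fwd c \o bwd e) (fwd e p) = fwd c p by rewrite /= ce.
have d2 : differentiable (f \o bwd c) (fwd c p).
  by apply: hol_differentiable (hf c Ac) _; exact: img_fwd.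
rewrite -pE in d2 *.
have [d3 E3] := has_df_comp d1 d2.
have agree x : img e (dom c) x ->
    (f \o bwd c) ((fwd c \o bwd e) x) = (f \o bwd e) x.
  by move=> /(imgP ce)[_ cx _]; rewrite /= cc.
have [_ E] := has_df_eq_on (atlas_compat Ae Ac).1 agree (img_fwd ep cp) d3.
exact: etrans (E u) (E3 u).
Qed.

Lemma vact_rep (f : N -> R[i]) (X : vfield N) c x : hol_fun O f ->
  atlas N c -> img c O x ->
  vact X f (bwd c x) = Df (f \o bwd c) x (vrep c X x).
Proof.
move=> hf Ac /(imgP (ha_atlas hN Ac).1)[cx Ox xE].
by rewrite /vact (dfun_chart _ hf Ac Ox cx) xE.
Qed.

Lemma vact_hol (f : N -> R[i]) (X : vfield N) : hol_fun O f -> hol_vf O X ->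
  hol_fun O (vact X f).
Proof.
move=> hf hX c Ac.
apply: (hol_ext (oO Ac)) (hol_Df_comp (oO Ac) (oO Ac) (fun _ => id) (hf c Ac)
  (hol_id (oO Ac)) (hX c Ac)).
by move=> x Ox; rewrite -vact_rep.
Qed.

Lemma hol_fun_differentiable (f : N -> R[i]) p : hol_fun O f -> O p ->
  differentiable (f \o bwd (pref N p)) (fwd (pref N p) p).
Proof.
move=> hf Op; have [Ae ep] := ha_pref hN p.
by apply: hol_differentiable (hf _ Ae) _; exact: img_fwd.
Qed.

Lemma dfun_ext (f g : N -> R[i]) p u : (forall q, O q -> f q = g q) ->
  hol_fun O f -> O p -> dfun g p u = dfun f p u.
Proof.
move=> fg hf Op; rewrite !dfunE; have [Ae ep] := ha_pref hN p.
have agree x : img (pref N p) O x ->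
    (f \o bwd (pref N p)) x = (g \o bwd (pref N p)) x.
  by move=> /(imgP (pref_local p).1)[_ Ox _]; exact: fg.
by have [_ E] := has_df_eq_on (oO Ae) agree (img_fwd ep Op)
  (hol_fun_differentiable hf Op).
Qed.

Lemma hol_fun_ext (f g : N -> R[i]) : (forall q, O q -> f q = g q) ->
  hol_fun O f -> hol_fun O g.
Proof.
move=> fg hf c Ac; apply: (hol_ext (oO Ac)) (hf c Ac) => x.
by move=> /(imgP (ha_atlas hN Ac).1)[_ Ox _]; exact: fg.
Qed.

Lemma hol_fun_cst (a : R[i]) : hol_fun O (fun=> a).
Proof. by move=> c Ac; exact: (hol_cst (oO Ac)). Qed.

Lemma hol_funD (f g : N -> R[i]) : hol_fun O f -> hol_fun O g ->
  hol_fun O (fun p => f p + g p).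
Proof. by move=> hf hg c Ac; exact: (holD (oO Ac) (hf c Ac) (hg c Ac)). Qed.

Lemma hol_funZ (a : R[i]) (f : N -> R[i]) : hol_fun O f ->
  hol_fun O (fun p => a *: f p).
Proof.
by move=> hf c Ac; apply: (holZ (oO Ac) (hol_cst (oO Ac) (a : R[i])) (hf c Ac)).
Qed.

Lemma hol_fun_sum m (f : 'I_m -> N -> R[i]) : (forall i, hol_fun O (f i)) ->
  hol_fun O (fun p => \sum_i f i p).
Proof.
move=> hf c Ac; exact: (hol_sum (oO Ac) (fun i => hf i c Ac)).
Qed.

Lemma dfunZ (a : R[i]) (f : N -> R[i]) p u : hol_fun O f -> O p ->
  dfun (fun p => a *: f p) p u = a *: dfun f p u.
Proof.
move=> hf Op; rewrite !dfunE; have df := hol_fun_differentiable hf Op.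
have [d0 E0] := has_df_cst (a : R[i]) (fwd (pref N p) p).
have [_ E] := has_dfZ d0 df.
apply: etrans (E u) _; rewrite [X in _ + X](_ : _ = 0); first exact: addr0.
by rewrite (E0 u); exact: scale0r.
Qed.

Lemma dfun_sum m (f : 'I_m -> N -> R[i]) p u : (forall i, hol_fun O (f i)) ->
  O p -> dfun (fun p => \sum_i f i p) p u = \sum_i dfun (f i) p u.
Proof.
move=> hf Op; rewrite dfunE.
have [_ E] := has_df_sum (fun i => hol_fun_differentiable (hf i) Op).
by apply: etrans (E u) _; apply: eq_bigr => i _; rewrite dfunE.
Qed.

Lemma hol_vf_sum m (X : 'I_m -> vfield N) : (forall i, hol_vf O (X i)) ->
  hol_vf O (fun p => \sum_i X i p).
Proof.
move=> hX c Ac; apply: (hol_ext (oO Ac)) (hol_sum (oO Ac) (fun i => hX i c Ac)).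
by move=> x _; rewrite /vrep tcoord_sum.
Qed.

(** Reduces fields to functions, so that holomorphy of a field follows from that
    of its action on coordinate functions. *)
Lemma hol_vf_coords (X : vfield N) :
  (forall d i, atlas N d ->
    hol_fun (O `&` dom d) (fun p => tcoord d p (X p) 0 i)) ->
  hol_vf O X.
Proof.
move=> hX c Ac; apply/(hol_rowP (oO Ac)) => i.
by rewrite -img_dom; exact: hX.
Qed.

Lemma bracketE (X Y : vfield N) p : bracket X Y p =
  Df (vrep (pref N p) Y) (fwd (pref N p) p) (X p)
  - Df (vrep (pref N p) X) (fwd (pref N p) p) (Y p).
Proof. exact: (congr2 (fun a b => a - b) (DfE _ _ _) (DfE _ _ _)). Qed.

Lemma vrep_pref (X : vfield N) p : vrep (pref N p) X (fwd (pref N p) p) = X p.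
Proof.
rewrite /vrep (pref_local p).1; last exact: (ha_pref hN p).2.
exact: tcoord_pref.
Qed.

(** The term that contains the second derivative of [f] is symmetric in [X p]
    and [Y p], and the other is what enters the bracket. *)
Lemma vact_vact (X Y : vfield N) (f : N -> R[i]) p :
  hol_fun O f -> hol_vf O Y -> O p ->
  let e := pref N p in let F := f \o bwd e in let x := fwd e p in
  vact X (vact Y f) p =
  Df (fun y => Df F y (Y p)) x (X p) + Df F x (Df (vrep e Y) x (X p)).
Proof.
move=> hf hY Op e F x; have [Ae ep] := ha_pref hN p.
have Dx : img e O x by exact: img_fwd.
have hA := hol_Df_comp (oO Ae) (oO Ae) (fun _ => id) (hf _ Ae)
  (hol_id (oO Ae)) (hY _ Ae).
have agree y : img e O y -> Df F y (vrep e Y y) = (vact Y f \o bwd e) y.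
  by move=> Dy; rewrite /= vact_rep.
have [_ E] := has_df_eq_on (oO Ae) agree Dx (hol_differentiable hA Dx).
rewrite {1}/vact dfunE; apply: etrans (E _) _.
have E2 := Df_Df_comp (X p) Dx (hf _ Ae) (hol_id (oO Ae))
  (hY _ Ae) Dx.
have [_ E3] := has_df_id x; rewrite (E3 (X p)) vrep_pref in E2.
exact: E2.
Qed.

(** The second derivatives of [f] cancel by symmetry. *)
Lemma vact_bracket (X Y : vfield N) (f : N -> R[i]) p :
  hol_fun O f -> hol_vf O X -> hol_vf O Y -> O p ->
  vact (bracket X Y) f p = vact X (vact Y f) p - vact Y (vact X f) p.
Proof.
move=> hf hX hY Op; have [Ae ep] := ha_pref hN p.
have Dx : img (pref N p) O (fwd (pref N p) p) by exact: img_fwd.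
rewrite (vact_vact X hf hY Op) (vact_vact Y hf hX Op).
rewrite (Df_sym _ _ (oO Ae) (hf _ Ae) Dx) {1}/vact dfunE bracketE DfB.
have common_term (a b b' : R[i]) : b - b' = a + b - (a + b').
  by rewrite opprD addrACA subrr add0r.
exact: common_term.
Qed.

End OnOpenSet.

Lemma dfun_coord c i p u : local_coordinates c -> dom c p ->
  dfun (fun q => fwd c q 0 i) p u = tcoord c p u 0 i.
Proof.
move=> hc cp; rewrite dfunE tcoordE.
have d1 := transition_differentiable (pref_local p).1 (compat_pref hc p).2
  (ha_pref hN p).2 cp.
by have [_ E] := has_df_coord i d1; exact: E.
Qed.

Lemma coord_hol_fun c i : local_coordinates c ->
  hol_fun (dom c) (fun q => fwd c q 0 i).
Proof.
move=> hc d Ad; have [_ [od hd]] := hc.2 d Ad.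
by have /(hol_rowP od) := hd; exact.
Qed.

(** The components of the bracket in a chart are its action on the coordinate
    functions, to which [vact_bracket] applies. *)
Lemma bracket_hol O (X Y : vfield N) : open_in O -> hol_vf O X -> hol_vf O Y ->
  hol_vf O (bracket X Y).
Proof.
move=> oO hX hY; apply: (hol_vf_coords oO) => d i Ad.
have hd := ha_atlas hN Ad.
have oO' := open_inI oO (dom_open hd).
have sO : O `&` dom d `<=` O by move=> p [].
have sd : O `&` dom d `<=` dom d by move=> p [].
have hf := hol_fun_sub sd (coord_hol_fun i hd).
have {}hX := hol_vf_sub sO hX; have {}hY := hol_vf_sub sO hY.
have h1 := vact_hol oO' (vact_hol oO' hf hY) hX.
have h2 := vact_hol oO' (vact_hol oO' hf hX) hY.
apply: (hol_fun_ext oO') (hol_funD oO' h1 (hol_funZ oO' (- 1) h2)) => p Op.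
rewrite -(dfun_coord _ _ hd (sd p Op)).
have := vact_bracket oO' hf hX hY Op; rewrite {1}/vact => ->.
by apply: (congr2 +%R) => //; exact: scaleN1r.
Qed.

(** The chart [c] need not belong to the atlas: in a chart [d] of the atlas the
    components of [X] are a derivative of the transition map from [c] to [d],
    evaluated along the transition map from [d] to [c]. *)
Lemma hol_vf_const c O (X : vfield N) a : local_coordinates c -> open_in O ->
  O `<=` dom c -> (forall p, O p -> tcoord c p (X p) = a) -> hol_vf O X.
Proof.
move=> hc oO Oc XE d Ad; have [cd dc] := hc.2 d Ad.
have sD : img d O `<=` img d (dom c) by exact: img_sub.
have DE x : img d O x -> img c (dom d) ((fwd c \o bwd d) x).
  move=> /(imgP (ha_atlas hN Ad).1)[dx Ox _].
  by apply: img_fwd => //; exact: Oc.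
have hE := hol_comp (oO d Ad) cd.1 DE (hol_sub sD dc.2) (hol_Df a cd.2).
apply: (hol_ext (oO d Ad)) hE => x /(imgP (ha_atlas hN Ad).1)[dx Ox _].
rewrite /vrep -(XE _ Ox).
by rewrite -(tcoord_transition (X (bwd d x)) hc cd (Oc _ Ox) dx).
Qed.

Lemma coord_vf_tcoord c j p : local_coordinates c -> dom c p ->
  tcoord c p (coord_vf c j p) = delta_mx 0 j.
Proof. by move=> hc cp; rewrite tvecK. Qed.

Lemma coord_vf_hol c j : local_coordinates c -> hol_vf (dom c) (coord_vf c j).
Proof.
move=> hc; apply: (hol_vf_const hc (dom_open hc) (@subset_refl _ _)) => p cp.
exact: coord_vf_tcoord.
Qed.

End Manifold.

(** * Formal exponentials *)

Section Sums.
Context {V : zmodType}.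
Implicit Type F : nat -> nat -> V.

(** Both sides run over the pairs with [i + j < K], by rows and by diagonals. *)
Lemma sum_triangle F K :
  \sum_(i < K) \sum_(j < K - i) F i j =
  \sum_(m < K) \sum_(i < m.+1) F i (m - i)%N.
Proof.
elim: K => [|K IH]; first by rewrite !big_ord0.
rewrite [RHS]big_ord_recr -IH /=.
have -> : \sum_(i < K) \sum_(j < K - i) F i j =
    \sum_(i < K.+1) \sum_(j < K - i) F i j.
  by rewrite big_ord_recr /= subnn big_ord0 addr0.
rewrite -big_split; apply: eq_bigr => i _ /=.
by rewrite subSn ?leq_ord // big_ord_recr.
Qed.

Lemma sum_antidiagonal_rev F K :
  \sum_(m < K) \sum_(i < m.+1) F i (m - i)%N =
  \sum_(m < K) \sum_(i < m.+1) F (m - i)%N i.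
Proof.
apply: eq_bigr => m _; rewrite (reindex_inj rev_ord_inj) /=.
apply: eq_bigr => i _; rewrite subSS subKn //; exact: leq_ord.
Qed.

Lemma sum_triangle_sym F K :
  \sum_(i < K) \sum_(j < K - i) F i j = \sum_(j < K) \sum_(i < K - j) F i j.
Proof.
rewrite (sum_triangle (fun j i => F i j)) sum_triangle.
exact: sum_antidiagonal_rev.
Qed.

Lemma sum_square F K : (forall a b, (K <= a + b)%N -> F a b = 0) ->
  \sum_(a < K) \sum_(b < K) F a b = \sum_(m < K) \sum_(i < m.+1) F i (m - i)%N.
Proof.
move=> F0; rewrite -sum_triangle; apply: eq_bigr => a _.
have leK : (K - a <= K)%N by exact: leq_subr.
rewrite (big_ord_widen _ (F a) leK) [RHS]big_mkcond /=; apply: eq_bigr => b _.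
by case: ltnP => // Kab; apply: F0; rewrite -leq_subLR.
Qed.

Lemma sum_pascal F m :
  \sum_(a < m.+1) (F a.+1 (m - a)%N *+ 'C(m, a) + F a (m - a).+1 *+ 'C(m, a)) =
  \sum_(a < m.+2) F a (m.+1 - a)%N *+ 'C(m.+1, a).
Proof.
rewrite big_split /=; set X := \sum_(a < _) _.
have -> : \sum_(a < m.+1) F a (m - a).+1 *+ 'C(m, a) =
    \sum_(a < m.+2) F a (m.+1 - a)%N *+ 'C(m, a).
  rewrite [RHS]big_ord_recr /= bin_small // mulr0n addr0.
  by apply: eq_bigr => a _; rewrite subSn ?leq_ord.
rewrite [in LHS]big_ord_recl [RHS]big_ord_recl /= !bin0 addrCA; congr (_ + _).
rewrite /X -big_split; apply: eq_bigr => a _ /=.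
by rewrite /bump /= add1n subSS binS mulrnDr addrC.
Qed.

End Sums.

Section SeriesOperators.
Context {R : realType} {T S : Type} {V : lmodType R[i]}.
Variables (op : S -> (T -> V) -> (T -> V)) (g : nat -> S).
Hypothesis op0 : forall f, op (g 0%N) f = fun=> 0.
Hypothesis opf0 : forall X, op X (fun=> 0) = fun=> 0.

(** As [g] has no term of order zero, each application of it raises the order. *)
Lemma iter_ser_op0 y m k : (k < m)%N -> iter m (ser_op op g) y k = fun=> 0.
Proof.
elim: m k => [//|m IH] k km; apply/funext => w /=; rewrite /ser_op.
apply: big1 => -[[|i] ik] _ /=; first by rewrite op0.
by rewrite IH ?opf0 //; lia.
Qed.

(** Allows the exponentials of series of different orders to be truncated at a
    common bound. *)
Lemma ser_exp_widen y K k w : (k < K)%N ->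
  ser_exp op g y k w =
  \sum_(m < K) (m`!%:R)^-1 *: iter m (ser_op op g) y k w.
Proof.
move=> kK; rewrite /ser_exp.
rewrite (big_ord_widen _
  (fun m => (m`!%:R)^-1 *: iter m (ser_op op g) y k w) kK).
rewrite big_mkcond /=; apply: eq_bigr => m _; case: ltnP => // km.
by rewrite iter_ser_op0 // scaler0.
Qed.

End SeriesOperators.

Lemma binomial_scale {K : numFieldType} {V : lmodType K} m a (x : V) :
  (a <= m)%N -> (m`!%:R)^-1 *: (x *+ 'C(m, a)) =
  (a`!%:R)^-1 *: ((m - a)`!%:R^-1 *: x).
Proof.
move=> am; rewrite -[x *+ _]scaler_nat !scalerA; congr (_ *: _).
have f0 j : (j`!%:R : K) != 0 by rewrite pnatr_eq0 -lt0n fact_gt0.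
have C0 : ('C(m, a)%:R : K) != 0 by rewrite pnatr_eq0 -lt0n bin_gt0.
rewrite -(bin_fact am) !natrM; move: (f0 a) (f0 (m - a)%N) C0.
move: (a`!%:R : K) ((m - a)`!%:R : K) ('C(m, a)%:R : K) => p q r p0 q0 r0.
by field; rewrite p0 q0 r0.
Qed.

Section SeriesOnManifold.
Context {R : realType} {n : nat} (N : charted R n) (hN : holomorphic_atlas N).
Variables (O : set N) (oO : open_in O).
Implicit Types (A : nat -> vfield N) (y : nat -> N -> R[i]).

Local Notation act := (ser_op (@vact R n N)).
Local Notation lie := (ser_op (@bracket R n N)).

Lemma ser_act_hol A y : (forall k, hol_vf O (A k)) ->
  (forall k, hol_fun O (y k)) -> forall k, hol_fun O (act A y k).
Proof.
move=> hA hy k; apply: (hol_fun_sum oO) => i; exact: vact_hol.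
Qed.

Lemma ser_lie_hol A B : (forall k, hol_vf O (A k)) ->
  (forall k, hol_vf O (B k)) -> forall k, hol_vf O (lie A B k).
Proof.
move=> hA hB k; apply: (hol_vf_sum oO) => i; exact: bracket_hol.
Qed.

Lemma ser_act_ext A y y' : (forall k, hol_fun O (y k)) ->
  (forall k w, O w -> y k w = y' k w) ->
  forall k w, O w -> act A y' k w = act A y k w.
Proof.
move=> hy yy' k w Ow; apply: eq_bigr => i _.
by apply: (dfun_ext hN oO) => //; exact: yy'.
Qed.

Lemma vact_sumr (X : vfield N) m (f : 'I_m -> N -> R[i]) p :
  (forall i, hol_fun O (f i)) -> O p ->
  vact X (fun p => \sum_i f i p) p = \sum_i vact X (f i) p.
Proof. by move=> hf Op; exact: (dfun_sum hN _ hf Op). Qed.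

Lemma dfun_suml (f : N -> R[i]) p m (u : 'I_m -> Cvec R n) :
  dfun f p (\sum_i u i) = \sum_i dfun f p (u i).
Proof. by rewrite dfunE Df_sumr; apply: eq_bigr => i _; rewrite dfunE. Qed.

(** Bracketing with [g] is a derivation of the action of fields on functions.
    After expansion this is [vact_bracket] for each pair of entries, summed over
    the triples of orders with a given total. *)
Lemma ser_leibniz g A y k w : (forall k, hol_vf O (g k)) ->
  (forall k, hol_vf O (A k)) -> (forall k, hol_fun O (y k)) -> O w ->
  act g (act A y) k w = act (lie g A) y k w + act A (act g y) k w.
Proof.
move=> hg hA hy Ow.
pose G i j l := vact (g i) (vact (A j) (y l)) w.
pose G' i j l := vact (A j) (vact (g i) (y l)) w.
have -> : act g (act A y) k w =
    \sum_(i < k.+1) \sum_(j < k.+1 - i) G i j (k - i - j)%N.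
  apply: eq_bigr => i _; rewrite subSn ?leq_ord //.
  apply: vact_sumr => // j; exact: vact_hol.
have -> : act A (act g y) k w =
    \sum_(j < k.+1) \sum_(i < k.+1 - j) G' i j (k - j - i)%N.
  apply: eq_bigr => j _; rewrite subSn ?leq_ord //.
  apply: vact_sumr => // i; exact: vact_hol.
have -> : act (lie g A) y k w =
    \sum_(m < k.+1) \sum_(i < m.+1)
      (G i (m - i)%N (k - m)%N - G' i (m - i)%N (k - m)%N).
  apply: eq_bigr => m _; rewrite {1}/vact /= /ser_op dfun_suml.
  apply: eq_bigr => i _; exact: (vact_bracket hN oO (hy _) (hg _) (hA _) Ow).
rewrite (sum_triangle (fun i j => G i j (k - i - j)%N)).
rewrite (sum_triangle_sym (fun j i => G' i j (k - j - i)%N)).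
rewrite (sum_triangle (fun i j => G' i j (k - j - i)%N)) -big_split.
apply: eq_bigr => m _; rewrite -big_split; apply: eq_bigr => i _ /=.
have [-> ->] : (k - i - (m - i) = k - m)%N /\ (k - (m - i) - i = k - m)%N.
  by have := ltn_ord i; lia.
by rewrite subrK.
Qed.

Lemma vactZr (X : vfield N) a (f : N -> R[i]) p : hol_fun O f -> O p ->
  vact X (fun p => a *: f p) p = a *: vact X f p.
Proof. by move=> hf Op; exact: (dfunZ hN _ _ hf Op). Qed.

Lemma ser_act_sum A m (a : 'I_m -> R[i]) (y : 'I_m -> nat -> N -> R[i]) k w :
  (forall i k, hol_fun O (y i k)) -> O w ->
  act A (fun k w => \sum_i a i *: y i k w) k w = \sum_i a i *: act A (y i) k w.
Proof.
move=> hy Ow; rewrite /ser_op.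
under [RHS]eq_bigr do rewrite scaler_sumr.
rewrite [RHS]exchange_big; apply: eq_bigr => j _ /=.
rewrite vact_sumr //; last by move=> i; exact: (hol_funZ oO).
by apply: eq_bigr => i _; rewrite vactZr.
Qed.

Section Flow.
Variable g : nat -> vfield N.
Hypotheses (g0 : g 0%N = fun=> 0) (hg : forall k, hol_vf O (g k)).

Lemma vact0 (f : N -> R[i]) : vact (g 0%N) f = fun=> 0.
Proof. by apply/funext => p; rewrite /vact g0 dfunE Df0. Qed.

Lemma vact_cst0 (X : vfield N) : vact X (fun=> 0 : R[i]) = fun=> 0.
Proof.
apply/funext => p; rewrite /vact dfunE.
have [_ E] := has_df_cst (0 : R[i]) (fwd (pref N p) p); exact: E.
Qed.

Lemma vrep_cst0 (c : chart R N n) : vrep c (fun=> 0 : Cvec R n) = fun=> 0.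
Proof. by apply/funext => x; rewrite /vrep tcoordE Df0. Qed.

Lemma Df_zero_fun x v : Df (fun _ : Cvec R n => 0 : Cvec R n) x v = 0.
Proof. have [_ E] := has_df_cst (0 : Cvec R n) x; exact: E. Qed.

Lemma bracket0 (Y : vfield N) : bracket (g 0%N) Y = fun=> 0.
Proof.
by apply/funext => p; rewrite g0 bracketE vrep_cst0 Df0 Df_zero_fun subrr.
Qed.

Lemma bracket_cst0 (X : vfield N) : bracket X (fun=> 0 : Cvec R n) = fun=> 0.
Proof.
by apply/funext => p; rewrite bracketE vrep_cst0 Df0 Df_zero_fun subrr.
Qed.

Lemma iter_act_hol y m : (forall k, hol_fun O (y k)) ->
  forall k, hol_fun O (iter m (act g) y k).
Proof. by move=> hy; elim: m => //= m IH; exact: ser_act_hol. Qed.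

Lemma iter_lie_hol A m : (forall k, hol_vf O (A k)) ->
  forall k, hol_vf O (iter m (lie g) A k).
Proof. by move=> hA; elim: m => //= m IH; exact: ser_lie_hol. Qed.

(** Iterating the derivation rule gives binomial coefficients. *)
Lemma iter_ser_leibniz A y m k w : (forall k, hol_vf O (A k)) ->
  (forall k, hol_fun O (y k)) -> O w ->
  iter m (act g) (act A y) k w = \sum_(a < m.+1)
    act (iter a (lie g) A) (iter (m - a) (act g) y) k w *+ 'C(m, a).
Proof.
move=> hA hy; elim: m k w => [|m IH] k w Ow.
  by rewrite big_ord1 /= mulr1n.
have hT a b j : hol_fun O (act (iter a (lie g) A) (iter b (act g) y) j).
  by apply: ser_act_hol => i; [exact: iter_lie_hol|exact: iter_act_hol].
pose s k w := \sum_(a < m.+1) ('C(m, a)%:R : R[i]) *: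
  act (iter a (lie g) A) (iter (m - a) (act g) y) k w.
have hs j : hol_fun O (s j).
  by apply: (hol_fun_sum oO) => a; exact: (hol_funZ oO).
have sE j v : O v -> s j v = iter m (act g) (act A y) j v.
  by move=> Ov; rewrite IH //; apply: eq_bigr => a _; rewrite scaler_nat.
rewrite iterS (ser_act_ext _ hs sE) // ser_act_sum //.
rewrite -(sum_pascal
  (fun a b => act (iter a (lie g) A) (iter b (act g) y) k w)).
apply: eq_bigr => a _; rewrite scaler_nat -mulrnDl; congr (_ *+ _).
by apply: ser_leibniz => // j; [exact: iter_lie_hol|exact: iter_act_hol].
Qed.

(** The exponential of a derivation is multiplicative: the binomial coefficients
    of [iter_ser_leibniz] cancel against the factorials. *)
Lemma ser_exp_act A y k w : (forall k, hol_vf O (A k)) ->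
  (forall k, hol_fun O (y k)) -> O w ->
  act (ser_exp (@bracket R n N) g A) (ser_exp (@vact R n N) g y) k w =
  ser_exp (@vact R n N) g (act A y) k w.
Proof.
move=> hA hy Ow.
pose T a b := act (iter a (lie g) A) (iter b (act g) y) k w.
have TE a b : T a b = \sum_(i < k.+1)
    dfun (iter b (act g) y (k - i)%N) w (iter a (lie g) A i w) by [].
have T0 a b : (k < a + b)%N -> T a b = 0.
  move=> kab; rewrite TE; apply: big1 => i _.
  case: (ltnP i a) => ia.
    by rewrite (iter_ser_op0 bracket0 bracket_cst0) // dfunE Df0.
  rewrite (iter_ser_op0 vact0 vact_cst0); last by have := ltn_ord i; lia.
  exact: (congr1 (fun f => f w) (vact_cst0 (fun=> iter a (lie g) A i w))).
have lhs : act (ser_exp (@bracket R n N) g A) (ser_exp (@vact R n N) g y) k w =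
    \sum_(a < k.+1) \sum_(b < k.+1)
      (a`!%:R : R[i])^-1 *: ((b`!%:R : R[i])^-1 *: T a b).
  transitivity (\sum_(i < k.+1) \sum_(a < k.+1) \sum_(b < k.+1)
      (a`!%:R : R[i])^-1 *: ((b`!%:R : R[i])^-1 *:
        dfun (iter b (act g) y (k - i)%N) w (iter a (lie g) A i w))).
    apply: eq_bigr => i _.
    have yE : ser_exp (@vact R n N) g y (k - i) = fun w => \sum_(b < k.+1)
        (b`!%:R : R[i])^-1 *: iter b (act g) y (k - i)%N w.
      apply/funext => v; apply: (ser_exp_widen vact0 vact_cst0).
      by rewrite ltnS leq_subr.
    rewrite /vact yE (ser_exp_widen bracket0 bracket_cst0 _ _ (ltn_ord i)).
    rewrite dfun_suml; apply: eq_bigr => a _.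
    rewrite dfunE DfZ -dfunE (dfun_sum hN (O := O)) //; last first.
      by move=> b; apply: (hol_funZ oO); exact: iter_act_hol.
    rewrite scaler_sumr; apply: eq_bigr => b _.
    by rewrite (dfunZ hN (O := O)) //; exact: iter_act_hol.
  rewrite exchange_big; apply: eq_bigr => a _ /=.
  rewrite exchange_big; apply: eq_bigr => b _ /=.
  by rewrite TE -!scaler_sumr.
pose c a b := (a`!%:R : R[i])^-1 *: ((b`!%:R : R[i])^-1 *: T a b).
have c0 a b : (k.+1 <= a + b)%N -> c a b = 0.
  by move=> kab; rewrite /c T0 // !scaler0.
apply: etrans lhs (etrans (sum_square c0) _).
apply: eq_bigr => m _; rewrite iter_ser_leibniz // scaler_sumr.
by apply: eq_bigr => a _; rewrite binomial_scale ?leq_ord.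
Qed.

Lemma ser_exp_hol y : (forall k, hol_fun O (y k)) ->
  forall k, hol_fun O (ser_exp (@vact R n N) g y k).
Proof.
move=> hy k; apply: (hol_fun_sum oO) => m; apply: (hol_funZ oO).
exact: iter_act_hol.
Qed.

(** Fields only see germs, so vanishing on an open set is preserved by [g]. *)
Lemma ser_exp_vanish y : (forall k w, O w -> y k w = 0) ->
  forall k w, O w -> ser_exp (@vact R n N) g y k w = 0.
Proof.
move=> y0 k w Ow; apply: big1 => m _; rewrite -[RHS](scaler0 _ (m`!%:R^-1)).
congr (_ *: _); move: (nat_of_ord m) => {m}m.
elim: m k w Ow => [|m IH] k w Ow; first exact: y0.
pose z (_ : nat) (_ : N) : R[i] := 0.
have hz i : hol_fun O (z i) := hol_fun_cst oO 0.
have zE i v : O v -> z i v = iter m (act g) y i v by move=> Ov; rewrite IH.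
rewrite iterS (ser_act_ext g hz zE) //.
apply: big1 => i _; exact: (congr1 (fun f => f w) (vact_cst0 (g i))).
Qed.

End Flow.
End SeriesOnManifold.

(** * The total space of the tangent bundle *)

Section RowBlocks.
Context {R : realType} {k n : nat}.

Lemma hol_row_mx (D : set (Cvec R k)) (f g : Cvec R k -> Cvec R n) :
  open D -> hol D f -> hol D g -> hol D (fun z => row_mx (f z) (g z)).
Proof.
move=> oD /(hol_rowP oD) hf /(hol_rowP oD) hg; apply/(hol_rowP oD) => i.
rewrite -(fintype.splitK i); case: (fintype.split i) => j /=.
  by apply: (hol_ext oD) (hf j) => z _; rewrite row_mxEl.
by apply: (hol_ext oD) (hg j) => z _; rewrite row_mxEr.
Qed.

Lemma Df_row_mx (f g : Cvec R k -> Cvec R n) z v :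
  differentiable (fun z => row_mx (f z) (g z)) z ->
  differentiable f z -> differentiable g z ->
  Df (fun z => row_mx (f z) (g z)) z v = row_mx (Df f z v) (Df g z v).
Proof.
move=> dfg df dg; apply/rowP => i.
rewrite -(fintype.splitK i); case: (fintype.split i) => j /=.
  have fE : (fun y => row_mx (f y) (g y) 0 (lshift n j)) = (fun y => f y 0 j).
    by apply/funext => y; rewrite row_mxEl.
  have [_ E1] := has_df_coord (lshift n j) dfg.
  have [_ E2] := has_df_coord j df.
  by rewrite row_mxEl -(E1 v) -(E2 v) fE.
have gE : (fun y => row_mx (f y) (g y) 0 (rshift n j)) = (fun y => g y 0 j).
  by apply/funext => y; rewrite row_mxEr.
have [_ E1] := has_df_coord (rshift n j) dfg.
have [_ E2] := has_df_coord j dg.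
by rewrite row_mxEr -(E1 v) -(E2 v) gE.
Qed.

End RowBlocks.

Section Submatrices.
Context {R : realType} {n : nat}.
Local Notation lsub := (@lsubmx R[i] 1 n n).
Local Notation rsub := (@rsubmx R[i] 1 n n).

Lemma has_df_lsubmx z : has_df lsub z lsub.
Proof. by apply: has_df_lin => y; exact: continuous_lsubmx. Qed.

Lemma has_df_rsubmx z : has_df rsub z rsub.
Proof. by apply: has_df_lin => y; exact: continuous_rsubmx. Qed.

Lemma hol_lsubmx (D : set (Cvec R (n + n))) : open D -> hol D lsub.
Proof.
move=> oD; apply/(hol_rowP oD) => i.
have /(hol_rowP oD)/(_ (lshift n i)) := hol_id oD.
by apply: (hol_ext oD) => z _; rewrite mxE.
Qed.

Lemma hol_rsubmx (D : set (Cvec R (n + n))) : open D -> hol D rsub.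
Proof.
move=> oD; apply/(hol_rowP oD) => i.
have /(hol_rowP oD)/(_ (rshift n i)) := hol_id oD.
by apply: (hol_ext oD) => z _; rewrite mxE.
Qed.

Lemma open_lsubmx (D : set (Cvec R n)) : open D -> open (lsub @^-1` D).
Proof. by move=> oD; apply: open_comp oD => z _; exact: continuous_lsubmx. Qed.

(** The tangent map of [phi] in coordinates: the transition map of the total
    space when [phi] is that of the base. *)
Definition tangent_trans (phi : Cvec R n -> Cvec R n) (z : Cvec R (n + n)) :=
  row_mx (phi (lsubmx z)) (Df phi (lsubmx z) (rsubmx z)).

Lemma tangent_trans_hol (D : set (Cvec R n)) (phi : Cvec R n -> Cvec R n) :
  open D -> hol D phi -> hol (lsub @^-1` D) (tangent_trans phi).
Proof.
move=> oD hphi; have oD' := open_lsubmx oD.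
apply: (hol_row_mx oD').
  exact: (hol_comp oD' oD (fun _ => id) (hol_lsubmx oD') hphi).
exact: (hol_Df_comp oD' oD (fun _ => id) hphi (hol_lsubmx oD')
  (hol_rsubmx oD')).
Qed.

(** A horizontal direction [u1] also moves the point at which [phi] is
    differentiated, whence the second derivative in the fibre component. *)
Lemma Df_tangent_trans (D : set (Cvec R n)) (phi : Cvec R n -> Cvec R n)
    x xi u1 u2 : open D -> hol D phi -> D x ->
  Df (tangent_trans phi) (row_mx x xi) (row_mx u1 u2) =
  row_mx (Df phi x u1) (Df (fun y => Df phi y xi) x u1 + Df phi x u2).
Proof.
move=> oD hphi Dx; have oD' := open_lsubmx oD.
have Dz : (lsub @^-1` D) (row_mx x xi) by rewrite /= row_mxKl.
have hl := hol_lsubmx oD'; have hr := hol_rsubmx oD'.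
have h1 := hol_comp oD' oD (fun _ => id) hl hphi.
have h2 := hol_Df_comp oD' oD (fun _ => id) hphi hl hr.
rewrite /tangent_trans (Df_row_mx _
  (hol_differentiable (tangent_trans_hol oD hphi) Dz)
  (hol_differentiable h1 Dz) (hol_differentiable h2 Dz)).
have lE : lsub (row_mx x xi) = x by rewrite row_mxKl.
have rE : rsub (row_mx x xi) = xi by rewrite row_mxKr.
have [_ El] := has_df_lsubmx (row_mx x xi).
have [_ Er] := has_df_rsubmx (row_mx x xi).
have Dl : D (lsub (row_mx x xi)) by [].
have [_ E1] := has_df_comp (hol_differentiable hl Dz)
  (hol_differentiable hphi Dl).
have E2 := Df_Df_comp (row_mx u1 u2) Dl hphi hl hr Dz.
rewrite (E1 (row_mx u1 u2)) E2 (El (row_mx u1 u2)) (Er (row_mx u1 u2)).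
by rewrite lE rE row_mxKl row_mxKr.
Qed.

End Submatrices.

Section TangentManifold.
Context {R : realType} {n : nat} (N : charted R n) (hN : holomorphic_atlas N).
Implicit Types (c d : chart R N n).

Lemma tchart_cancel c : local_coordinates c -> chart_cancel (tchart c).
Proof.
move=> hc [p xi] /= cp.
by rewrite row_mxKl row_mxKr hc.1 // (tcoordK hN hc).
Qed.

(** Charts of the total space contain entire fibres. *)
Lemma img_tchart c d : local_coordinates c ->
  img (tchart c) (dom (tchart d)) = @lsubmx R[i] 1 n n @^-1` img c (dom d).
Proof.
move=> hc; apply/seteqP; split=> z.
  by move=> [w [cw dw] <-]; rewrite /= row_mxKl; exists w.1.
move=> [p [cp dp] zE]; exists (p, tvec c p (rsubmx z)) => //=.
by rewrite (tvecK hN hc) // zE hsubmxK.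
Qed.

Lemma tchart_transition c d z : local_coordinates c -> local_coordinates d ->
  compatible c d -> img c (dom d) (lsubmx z) ->
  tangent_trans (fwd d \o bwd c) z = (fwd (tchart d) \o bwd (tchart c)) z.
Proof.
move=> hc hd cd [p [cp dp] zE].
rewrite /tangent_trans -zE /= -zE hc.1 // (tcoord_tvec hN _ hc cd) //.
Qed.

Lemma tchart_compatible c d : local_coordinates c -> local_coordinates d ->
  compatible c d -> compatible (tchart c) (tchart d).
Proof.
move=> hc hd cd; have oD := open_lsubmx cd.1.
rewrite /compatible img_tchart //; split=> //.
apply: (hol_ext oD) (tangent_trans_hol cd.1 cd.2) => z Dz.
exact: tchart_transition.
Qed.

Lemma tchart_local c : local_coordinates c ->
  local_coordinates (N := tangent N) (tchart c).
Proof.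
move=> hc; split; first exact: tchart_cancel.
move=> _ [d Ad <-]; have hd := ha_atlas hN Ad; have [cd dc] := hc.2 d Ad.
by split; exact: tchart_compatible.
Qed.

Lemma tangent_atlas : holomorphic_atlas (tangent N).
Proof.
split; last by move=> _ [c Ac <-]; exact: tchart_local (ha_atlas hN Ac).
by move=> w; have [Ae ep] := ha_pref hN w.1; split=> //; exists (pref N w.1).
Qed.

(** Components of a tangent vector of the total space in the chart induced by
    [c]; the preferred chart at [w] is itself induced from the base, so the
    formula is [Df_tangent_trans] for the transition to [c]. *)
Lemma tcoord_tchart c (w : tangent N) u1 u2 : local_coordinates c ->
  dom c w.1 -> let phi := fwd c \o bwd (pref N w.1) in
  let x := fwd (pref N w.1) w.1 in
  tcoord (N := tangent N) (tchart c) w (row_mx u1 u2) =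
  row_mx (tcoord c w.1 u1) (Df (fun y => Df phi y w.2) x u1 + tcoord c w.1 u2).
Proof.
move=> hc cp phi x; set e := pref N w.1.
have [Ae ep] := ha_pref hN w.1; have he := ha_atlas hN Ae.
have [ce ec] := compat_pref hN hc w.1.
have Dx : img e (dom c) x by exact: img_fwd.
rewrite !(tcoordE (N := N)) -(Df_tangent_trans _ _ _ ec.1 ec.2 Dx).
rewrite (tcoordE (N := tangent N)) /=.
have xE : row_mx (fwd e w.1) (tcoord e w.1 w.2) = row_mx x w.2.
  by rewrite (tcoord_pref hN).
rewrite -/e xE.
have Dz : (@lsubmx R[i] 1 n n @^-1` img e (dom c)) (row_mx x w.2).
  by rewrite /= row_mxKl.
have agree z := @tchart_transition e c z he hc ec.
have dT := hol_differentiable (tangent_trans_hol ec.1 ec.2) Dz.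
have [_ E] := has_df_eq_on (open_lsubmx ec.1) agree Dz dT.
exact: E.
Qed.

End TangentManifold.

(** * Flat coordinates *)

Lemma complex_manifold_atlas (R : realType) (n : nat) (M : charted R n) :
  complex_manifold M -> holomorphic_atlas M.
Proof. by case=> pM aM _ _; split. Qed.

Section FlatCoordinates.
Context {R : realType} {n : nat} (M : charted R n) (hM : holomorphic_atlas M).
Variables (Om : form2 M) (nab : christoffel M) (c : chart R M n).
Hypothesis flat_c : flat_darboux Om nab c.

Let hc : local_coordinates c. Proof. by case: flat_c. Qed.
Let hT : holomorphic_atlas (tangent M) := tangent_atlas hM.
Let hTc : local_coordinates (N := tangent M) (tchart c) := tchart_local hM hc.
Let O : set (tangent M) := dom (tchart c).

Lemma tcoord_vlift (w : tangent M) u : dom c w.1 ->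
  tcoord (N := tangent M) (tchart c) w (vlift u) = row_mx 0 (tcoord c w.1 u).
Proof.
by move=> cp; rewrite /vlift (tcoord_tchart hM) // !tcoordE !Df0 add0r.
Qed.

(** Flatness of [dZ^i] says that [X (dZ^i Y) = dZ^i (cov X Y)]. For fields with
    constant components in the preferred chart the right-hand side reduces to
    the Christoffel tensor and the left-hand side to the second derivative of
    the coordinate change. *)
Lemma flat_christoffel p u xi : dom c p ->
  Df (fun y => Df (fwd c \o bwd (pref M p)) y xi) (fwd (pref M p) p) u =
  tcoord c p (nab p u xi).
Proof.
move=> cp; set e := pref M p; set x := fwd e p; set phi := fwd c \o bwd e.
have [Ae ep] := ha_pref hM p; have he := ha_atlas hM Ae.
have [ce ec] := compat_pref hM hc p.
pose V := dom c `&` dom e.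
have oV : open_in V := open_inI hM (dom_open hc) (dom_open he).
pose cf v : vfield M := fun q => tvec e q v.
have hcf v : hol_vf V (cf v).
  apply: (hol_vf_const hM he oV); first by move=> q [].
  by move=> q [_ eq]; exact: (tvecK hM he _ eq).
have cfp v : cf v p = v.
  by have := tcoordK hM he v ep; rewrite (tcoord_pref hM).
have Vp : V p by split.
have Dx : img e V x by exact: img_fwd.
have oD : open (img e V) by exact: oV.
have covE : cov nab (cf u) (cf xi) p = nab p u xi.
  rewrite /cov !cfp -[RHS]add0r; apply: (congr2 +%R) => //.
  apply: etrans (DfE _ _ _) _.
  have agree y : img e V y -> xi = vrep e (cf xi) y.
    move=> /(imgP he.1)[ey _ _]; rewrite /vrep; exact: esym (tvecK hM he _ ey).
  have [d0 E0] := has_df_cst xi x.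
  have [_ E] := has_df_eq_on oD agree Dx d0.
  exact: etrans (E u) (E0 u).
apply/rowP => i.
have [_ flat _] := flat_c.
have Vc : V `<=` dom c by move=> q [].
have := flat i V (cf u) (cf xi) oV Vc (hcf u) (hcf xi) p Vp.
rewrite /cov_form covE (dfun_coord hM _ _ hc cp) => /subr0_eq <-.
rewrite /vact cfp dfunE.
have dphi : differentiable (fun y => Df phi y xi) x.
  by apply: hol_differentiable (hol_Df xi ec.2) _; exact: img_fwd.
have [dphii E1] := has_df_coord i dphi.
have agree y : img e V y -> Df phi y xi 0 i =
    ((fun q => dfun (fun q => fwd c q 0 i) q (cf xi q)) \o bwd e) y.
  move=> /(imgP he.1)[ey [cy _] yE].
  rewrite /= (dfun_coord hM _ _ hc cy) (tcoord_tvec hM _ he ec ey cy) yE //.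
have [_ E] := has_df_eq_on oD agree Dx dphii.
rewrite -/e -/x; apply: etrans (esym (E1 u)) _.
exact: esym (E u).
Qed.

(** In flat coordinates horizontal lifts have no fibre component: the
    Christoffel tensor cancels the second derivative of the coordinate
    change. *)
Lemma tcoord_ehresmann (w : tangent M) u : dom c w.1 ->
  tcoord (N := tangent M) (tchart c) w (ehresmann nab w u) =
  row_mx (tcoord c w.1 u) 0.
Proof.
move=> cp; rewrite /ehresmann (tcoord_tchart hM) // flat_christoffel //.
by rewrite !tcoordE DfN addrN.
Qed.

Let A j := formal_lift (ehresmann nab) (coord_vf c j).

Lemma tcoord_formal_lift0 j (w : tangent M) : O w ->
  tcoord (N := tangent M) (tchart c) w (A j 0%N w) = row_mx 0 (delta_mx 0 j).
Proof. by move=> cw; rewrite tcoord_vlift // (coord_vf_tcoord hM). Qed.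

Lemma tcoord_formal_lift1 j (w : tangent M) : O w ->
  tcoord (N := tangent M) (tchart c) w (A j 1%N w) = row_mx (delta_mx 0 j) 0.
Proof.
by move=> cw; rewrite /A /= /hlift tcoord_ehresmann // (coord_vf_tcoord hM).
Qed.

Lemma total_open : open_in O. Proof. exact: dom_open hTc. Qed.

Lemma formal_lift_hol j k : hol_vf O (A j k).
Proof.
have cst := hol_vf_const hT hTc total_open (@subset_refl _ _).
case: k => [|[|k]].
- apply: cst => w; exact: tcoord_formal_lift0.
- apply: cst => w; exact: tcoord_formal_lift1.
- by apply: (cst _ 0) => w _; rewrite tcoordE Df0.
Qed.

Lemma x_st_hol i k : hol_fun O (x_st c i k).
Proof.
have hx l := coord_hol_fun l hTc.
case: k => [|[|k]].
- apply: (hol_fun_ext hT total_open)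
    (hol_funZ total_open (- 1) (hx (lshift n i))).
  by move=> w _; exact: scaleN1r.
- exact: hx.
- exact: (hol_fun_cst total_open).
Qed.

Lemma vact_x_st0 (X : vfield (tangent M)) i (w : tangent M) : O w ->
  vact X (x_st c i 0%N) w =
  - tcoord (N := tangent M) (tchart c) w (X w) 0 (lshift n i).
Proof.
move=> Ow; rewrite /vact -(dfun_coord hT _ _ hTc Ow).
have hz := coord_hol_fun (lshift n i) hTc.
have E := dfun_ext hT total_open (X w) _ (hol_funZ total_open (- 1) hz) Ow.
apply: etrans (E _ _) _; first by move=> v _; exact: scaleN1r.
by apply: etrans (dfunZ hT (- 1) (X w) hz Ow) _; exact: scaleN1r.
Qed.

Lemma vact_x_st1 (X : vfield (tangent M)) i (w : tangent M) : O w ->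
  vact X (x_st c i 1%N) w =
  tcoord (N := tangent M) (tchart c) w (X w) 0 (rshift n i).
Proof. by move=> Ow; exact: (dfun_coord hT _ _ hTc Ow). Qed.

(** The coordinates [x_st] are parallel for the trivial connection. The only
    order with nonzero terms is the next-to-lowest one, where [d theta^i]
    evaluated on the vertical lift cancels [d Z^i] evaluated on the horizontal
    lift. *)
Lemma trivial_connection_x_st i j k (w : tangent M) : O w ->
  ser_op (@vact R (n + n) (tangent M)) (A j) (x_st c i) k w = 0.
Proof.
move=> Ow.
have A0 l f : vact (A j l.+2) f w = 0 by rewrite /vact dfunE Df0.
have x0 X l : vact X (x_st c i l.+2) w = 0.
  exact: (congr1 (fun f => f w) (vact_cst0 X)).
case: k => [|[|k]].
- rewrite /ser_op big_ord1 vact_x_st0 // tcoord_formal_lift0 //.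
  by rewrite row_mxEl mxE oppr0.
- rewrite /ser_op big_ord_recl big_ord1 /= vact_x_st1 // vact_x_st0 //.
  rewrite tcoord_formal_lift0 // tcoord_formal_lift1 //.
  by rewrite row_mxEl row_mxEr subrr.
rewrite /ser_op; apply: big1 => -[[|[|l]] lk] _ /=.
- exact: x0.
- case: k lk => [|k] lk; last exact: x0.
  by rewrite vact_x_st1 // tcoord_formal_lift1 // row_mxEr mxE.
- exact: A0.
Qed.

End FlatCoordinates.

Theorem proposition3p8 (R : realType) (n : nat) (M : charted R n)
    (Om : form2 M) (Gam : M -> set (Cvec R n)) (nab : christoffel M)
    (Z : vfield M) (h : lift_map M) (g : nat -> vfield (tangent M))
    (c : chart R M n) :
  complex_manifold M ->
  joyce_structure Om Gam nab Z h ->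
  Lie_Ghat g ->
  gauge_equiv g (ehresmann nab) h ->
  flat_darboux Om nab c ->
  (forall i k, hol_fun (@tproj R n M @^-1` dom c) (x_coord g c i k)) /\
  (forall (i j : 'I_n) k (w : tangent M), dom c (tproj w) ->
    ser_op (@vact R (n + n) (tangent M)) (formal_lift h (coord_vf c j))
      (x_coord g c i) k w = 0).
Proof.
move=> /complex_manifold_atlas hM _ [g0 hg] gauge flat_c.
have hT := tangent_atlas hM.
have hc : local_coordinates c by case: flat_c.
pose O : set (tangent M) := @tproj R n M @^-1` dom c.
have oO : open_in O := total_open hM flat_c.
have {}hg k : hol_vf O (g k) by apply: hol_vf_sub (hg k).1.
have hx i k : hol_fun O (x_st c i k) := x_st_hol hM flat_c i k.
split=> [i k|i j k w cw]; first exact: (ser_exp_hol hT oO hg).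
have hA l : hol_vf O _ := formal_lift_hol hM flat_c j l.
have hX : hol_vf (dom c) (coord_vf c j) := coord_vf_hol hM j hc.
have liftE l : ser_exp (@bracket R _ (tangent M)) g
    (formal_lift (ehresmann nab) (coord_vf c j)) l w =
    formal_lift h (coord_vf c j) l w.
  exact: (gauge (dom c)) (dom_open hc) hX _ _ cw.
transitivity (ser_op (@vact R _ (tangent M)) (ser_exp (@bracket R _ (tangent M))
  g (formal_lift (ehresmann nab) (coord_vf c j))) (x_coord g c i) k w).
  by apply: eq_bigr => l _; rewrite /vact liftE.
rewrite (ser_exp_act hT oO g0 hg k hA (hx i)) //.
have y0 l (v : tangent M) (Ov : O v) :=
  trivial_connection_x_st hM flat_c i j l Ov.
exact: (ser_exp_vanish hT oO g y0).
Qed.
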